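(* Let $\overline{\mathcal{X}}\in\mathbb{X}$ be a stationary point of problem (P) and let $(\overline{\lambda},\overline{\mathcal{Y}})\in\mathcal{M}(\overline{\mathcal{X}})$. Suppose that (1) the second-order sufficient condition holds at $\overline{\mathcal{X}}$, i.e. \[ \sup_{(\lambda,\mathcal{Y})\in\mathcal{M}(\overline{\mathcal{X}})}\Big\{\big\langle \mathcal{Z},\nabla^2_{\mathcal{X}\mathcal{X}}L(\overline{\mathcal{X}};\lambda,\mathcal{Y})\mathcal{Z}\big\rangle-\sigma\big(\mathcal{Y},\mathcal{T}^2_K(G(\overline{\mathcal{X}}),G'(\overline{\mathcal{X}})\mathcal{Z})\big)\Big\}>0\quad\text{for all }\mathcal{Z}\in\mathcal{C}(\overline{\mathcal{X}})\setminus\{0\}; \] (2) $(\overline{\lambda},\overline{\mathcal{Y}})$ satisfies the strict Robinson constraint qualification \[ \begin{pmatrix}h'(\overline{\mathcal{X}})\\ G'(\overline{\mathcal{X}})\end{pmatrix}\mathbb{X}+\begin{pmatrix}\{0\}\\ \mathcal{T}_K(G(\overline{\mathcal{X}}))\cap\overline{\mathcal{Y}}^{\perp}\end{pmatrix}=\begin{pmatrix}\mathbb{R}^p\\ \mathbb{X}\end{pmatrix}. \] Then both multifunctions $\mathcal{J}$ and $\widetilde{\mathcal{J}}$ are locally upper Lipschitz at the origin $0\in\mathbb{X}\times\mathbb{R}^p\times\mathbb{X}$ for $(\overline{\mathcal{X}},\overline{\lambda},\overline{\mathcal{Y}})$.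
   Context: Let $m\le n$ and $1\le k\le m$ be integers, $\mathbb{X}=\mathbb{R}\times\mathbb{R}^{m\times n}$ with inner product $\langle(t,X),(s,Y)\rangle=ts+\mathrm{tr}(X^{T}Y)$ and induced norm. For $X\in\mathbb{R}^{m\times n}$ let $\sigma_1(X)\ge\dots\ge\sigma_m(X)$ be its singular values. The Ky Fan $k$-norm matrix cone is $K=\{(t,X)\in\mathbb{X}:\sum_{i=1}^k\sigma_i(X)\le t\}$, a closed convex cone; $K^\circ$ is its polar cone, $\Pi_K$ the Euclidean projection onto $K$, $\mathcal{N}_K$ the normal cone of convex analysis, $\mathcal{T}_K(x)$ the contingent (tangent) cone at $x\in K$, and $\mathcal{T}^2_K(x,d)=\{w:\mathrm{dist}(x+td+\tfrac12t^2w,K)=o(t^2),\ t\downarrow0\}$ the outer second-order tangent set; $\sigma(y,S)=\sup_{w\in S}\langle y,w\rangle$ is the support function. For $\mathcal{Y}\in\mathbb{X}$, $\mathcal{Y}^\perp=\{\mathcal{Z}:\langle\mathcal{Z},\mathcal{Y}\rangle=0\}$. Problem (P): $\min_{\mathcal{X}\in\mathbb{X}}\{f(\mathcal{X}): h(\mathcal{X})=0,\ G(\mathcal{X})\in K\}$ with $f:\mathbb{X}\to\mathbb{R}$, $h:\mathbb{X}\to\mathbb{R}^p$, $G:\mathbb{X}\to\mathbb{X}$ twice continuously differentiable. Lagrangian $L(\mathcal{X};\lambda,\mathcal{Y})=f(\mathcal{X})+\langle h(\mathcal{X}),\lambda\rangle+\langle G(\mathcal{X}),\mathcal{Y}\rangle$.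 For feasible $\overline{\mathcal{X}}$, $\mathcal{M}(\overline{\mathcal{X}})$ is the set of $(\lambda,\mathcal{Y})\in\mathbb{R}^p\times\mathbb{X}$ with $L'_{\mathcal{X}}(\overline{\mathcal{X}};\lambda,\mathcal{Y})=0$ and $\mathcal{Y}\in\mathcal{N}_K(G(\overline{\mathcal{X}}))$; $\overline{\mathcal{X}}$ is stationary if $\mathcal{M}(\overline{\mathcal{X}})\neq\emptyset$. Critical cone: $\mathcal{C}(\overline{\mathcal{X}})=\{\mathcal{Z}: h'(\overline{\mathcal{X}})\mathcal{Z}=0,\ G'(\overline{\mathcal{X}})\mathcal{Z}\in\mathcal{T}_K(G(\overline{\mathcal{X}})),\ \langle f'(\overline{\mathcal{X}}),\mathcal{Z}\rangle=0\}$. Define $\Psi(\mathcal{X},\lambda,\mathcal{Y})=\big(L'_{\mathcal{X}}(\mathcal{X};\lambda,\mathcal{Y}),\,h(\mathcal{X}),\,G(\mathcal{X})-\Pi_K(G(\mathcal{X})+\mathcal{Y})\big)$, and for $\delta=(\delta_f,\delta_h,\delta_G)\in\mathbb{X}\times\mathbb{R}^p\times\mathbb{X}$, $\widetilde{\Psi}(\delta,\mathcal{X},\lambda,\mathcal{Y})=\big(L'_{\mathcal{X}}(\mathcal{X};\lambda,\mathcal{Y})-\delta_f,\,h(\mathcal{X})-\delta_h,\,G(\mathcal{X})-\delta_G-\Pi_K(G(\mathcal{X})-\delta_G+\mathcal{Y})\big)$. Solution maps: $\mathcal{J}(\delta)=\{(\mathcal{X},\lambda,\mathcal{Y}):\Psi(\mathcal{X},\lambda,\mathcal{Y})=\delta\}$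 and $\widetilde{\mathcal{J}}(\delta)=\{(\mathcal{X},\lambda,\mathcal{Y}):\widetilde{\Psi}(\delta,\mathcal{X},\lambda,\mathcal{Y})=0\}$. A multifunction $\mathcal{S}:\mathbb{Y}\rightrightarrows\mathbb{Z}$ between finite-dimensional normed spaces is locally upper Lipschitz at $\overline{y}$ for $\overline{z}\in\mathcal{S}(\overline{y})$ if there exist $\mu\ge0$ and neighborhoods $\mathcal{U}$ of $\overline{y}$, $\mathcal{V}$ of $\overline{z}$ with $\mathcal{V}\cap\mathcal{S}(\overline{y})=\{\overline{z}\}$ and $\mathcal{S}(y)\cap\mathcal{V}\subseteq\{\overline{z}\}+\mu\|y-\overline{y}\|\mathbb{B}$ for all $y\in\mathcal{U}$ ($\mathbb{B}$ the closed unit ball of $\mathbb{Z}$). *)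

(* Defs.v *)
From Stdlib Require Export Reals ClassicalEpsilon.
From mathcomp Require Export ssreflect ssrfun ssrbool eqtype ssrnat seq fintype bigop.
Unset Implicit Arguments.
Unset Strict Implicit.
Unset Printing Implicit Defensive.
Open Scope R_scope.

Record ESpace := {
  car :> Type;
  ezero : car;
  eadd : car -> car -> car;
  escal : R -> car -> car;
  eip : car -> car -> R }.
Arguments ezero {_}.
Arguments eadd {_} _ _.
Arguments escal {_} _ _.
Arguments eip {_} _ _.

Definition esub {E : ESpace} (u v : E) : E := eadd u (escal (-1) v).
Definition enorm {E : ESpace} (u : E) : R := sqrt (eip u u).

Definition RSp : ESpace := {| car := R; ezero := 0; eadd := Rplus; escal := Rmult; eip := Rmult |}.

Definition RvSp (p : nat) : ESpace :=
  {| car := 'I_p -> R; ezero := fun _ => 0;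
     eadd := fun u v i => u i + v i;
     escal := fun a u i => a * u i;
     eip := fun u v => \big[Rplus/0]_(i < p) (u i * v i) |}.

Definition Mat (m n : nat) := 'I_m -> 'I_n -> R.
Definition matip (m n : nat) (A B : Mat m n) : R :=
  \big[Rplus/0]_(i < m) \big[Rplus/0]_(j < n) (A i j * B i j).

Definition XSp (m n : nat) : ESpace :=
  {| car := (R * Mat m n)%type;
     ezero := (0, fun _ _ => 0);
     eadd := fun u v => (u.1 + v.1, fun i j => u.2 i j + v.2 i j);
     escal := fun a u => (a * u.1, fun i j => a * u.2 i j);
     eip := fun u v => u.1 * v.1 + matip m n u.2 v.2 |}.

Definition prodSp (E F : ESpace) : ESpace :=
  {| car := (E * F)%type;
     ezero := (ezero, ezero);
     eadd := fun u v => (eadd u.1 v.1, eadd u.2 v.2);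
     escal := fun a u => (escal a u.1, escal a u.2);
     eip := fun u v => eip u.1 v.1 + eip u.2 v.2 |}.

Definition is_linear {E F : ESpace} (L : E -> F) : Prop :=
  (forall u v, L (eadd u v) = eadd (L u) (L v)) /\
  (forall a u, L (escal a u) = escal a (L u)).

Definition has_deriv {E F : ESpace} (g : E -> F) (Dg : E -> E -> F) : Prop :=
  forall x, is_linear (Dg x) /\
    forall eps, 0 < eps -> exists del, 0 < del /\
      forall d, enorm d < del ->
        enorm (esub (esub (g (eadd x d)) (g x)) (Dg x d)) <= eps * enorm d.

Definition C2 {E F : ESpace} (g : E -> F) (Dg : E -> E -> F) (D2g : E -> E -> E -> F) : Prop :=
  has_deriv g Dg /\
  (forall d, has_deriv (fun x => Dg x d) (fun x e => D2g x d e)) /\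
  (forall x d e eps, 0 < eps -> exists del, 0 < del /\
     forall x', enorm (esub x' x) < del -> enorm (esub (D2g x' d e) (D2g x d e)) < eps).

Definition normal_cone {E : ESpace} (S : E -> Prop) (x y : E) : Prop :=
  forall z, S z -> eip y (esub z x) <= 0.

(* contingent cone: liminf_{t -> 0+} dist(x + t d, S)/t = 0 *)
Definition tangent_cone {E : ESpace} (S : E -> Prop) (x d : E) : Prop :=
  forall eps T, 0 < eps -> 0 < T -> exists t, 0 < t < T /\
    exists d', enorm (esub d' d) < eps /\ S (eadd x (escal t d')).

Definition tangent2 {E : ESpace} (S : E -> Prop) (x d w : E) : Prop :=
  forall eps, 0 < eps -> exists T, 0 < T /\ forall t, 0 < t < T ->
    exists z, S z /\
      enorm (esub (eadd x (eadd (escal t d) (escal (t * t / 2) w))) z) < eps * (t * t).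

(* sigma(y, W) < a, where sigma is the (extended-real valued) support function
   sup_{w in W} <y,w> *)
Definition support_lt {E : ESpace} (y : E) (W : E -> Prop) (a : R) : Prop :=
  exists r, r < a /\ forall w, W w -> eip y w <= r.

(* Euclidean projection onto S: the (unique, for closed convex nonempty S)
   minimiser of the distance *)
Definition is_proj {E : ESpace} (S : E -> Prop) (z w : E) : Prop :=
  S w /\ forall w', S w' -> enorm (esub z w) <= enorm (esub z w').
Definition proj {E : ESpace} (S : E -> Prop) (z : E) : E :=
  epsilon (inhabits ezero) (is_proj S z).

Definition orthogonal_mx (q : nat) (U : Mat q q) : Prop :=
  forall i j : 'I_q, \big[Rplus/0]_(l < q) (U l i * U l j) = (if i == j then 1 else 0).

(* X = U [diag(s) 0] V^T is a singular value decomposition of X (m <= n),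
   s_1 >= ... >= s_m >= 0 being the singular values *)
Definition svd (m n : nat) (U : Mat m m) (V : Mat n n) (s : 'I_m -> R) (X : Mat m n) : Prop :=
  orthogonal_mx m U /\ orthogonal_mx n V /\
  (forall i, 0 <= s i) /\
  (forall i j : 'I_m, (i <= j)%N -> s j <= s i) /\
  (forall i j, X i j =
     \big[Rplus/0]_(l < m) \big[Rplus/0]_(c < n)
        (U i l * (if nat_of_ord l == nat_of_ord c then s l else 0) * V j c)).

Definition KyFanCone (m n k : nat) (x : XSp m n) : Prop :=
  exists U V s, svd m n U V s x.2 /\
    \big[Rplus/0]_(l < m | (l < k)%N) s l <= x.1.

Section Problem.
Variables (m n k p : nat).
Notation XX := (XSp m n).
Notation Rp := (RvSp p).
Variables (Df : XX -> XX -> RSp) (D2f : XX -> XX -> XX -> RSp).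
Variables (h : XX -> Rp) (Dh : XX -> XX -> Rp) (D2h : XX -> XX -> XX -> Rp).
Variables (G : XX -> XX) (DG : XX -> XX -> XX) (D2G : XX -> XX -> XX -> XX).

Definition K := KyFanCone m n k.

Definition riesz (phi : XX -> R) : XX :=
  (phi (1, fun _ _ => 0),
   fun i j => phi (0, fun i' j' => if (i' == i) && (j' == j) then 1 else 0)).

Definition LX (x : XX) (lam : Rp) (Y : XX) : XX :=
  riesz (fun d => Df x d + eip lam (Dh x d) + eip Y (DG x d)).

Definition LXXquad (x : XX) (lam : Rp) (Y : XX) (Z : XX) : R :=
  D2f x Z Z + eip lam (D2h x Z Z) + eip Y (D2G x Z Z).

Definition feasible (x : XX) : Prop := h x = ezero /\ K (G x).

Definition multipliers (x : XX) (lam : Rp) (Y : XX) : Prop :=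
  LX x lam Y = ezero /\ normal_cone K (G x) Y.

Definition stationary (x : XX) : Prop :=
  feasible x /\ exists lam Y, multipliers x lam Y.

Definition critical_cone (x Z : XX) : Prop :=
  Dh x Z = ezero /\ tangent_cone K (G x) (DG x Z) /\ Df x Z = 0.

Definition SOSC (x : XX) : Prop :=
  forall Z, critical_cone x Z -> Z <> ezero ->
    exists lam Y, multipliers x lam Y /\
      support_lt Y (tangent2 K (G x) (DG x Z)) (LXXquad x lam Y Z).

Definition SRCQ (x : XX) (Y : XX) : Prop :=
  forall (a : Rp) (B : XX), exists Z W,
    tangent_cone K (G x) W /\ eip W Y = 0 /\
    Dh x Z = a /\ eadd (DG x Z) W = B.

Definition TripleSp := prodSp XX (prodSp Rp XX).

Definition Psi (z : TripleSp) : TripleSp :=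
  let: (x, (lam, Y)) := z in
  (LX x lam Y, (h x, esub (G x) (proj K (eadd (G x) Y)))).

Definition Psit (delta z : TripleSp) : TripleSp :=
  let: (df, (dh, dG)) := delta in
  let: (x, (lam, Y)) := z in
  (esub (LX x lam Y) df,
   (esub (h x) dh,
    esub (esub (G x) dG) (proj K (eadd (esub (G x) dG) Y)))).

Definition J (delta z : TripleSp) : Prop := Psi z = delta.
Definition Jt (delta z : TripleSp) : Prop := Psit delta z = ezero.
End Problem.

Definition loc_upper_lipschitz {Y Z : ESpace} (S : Y -> Z -> Prop) (ybar : Y) (zbar : Z) : Prop :=
  S ybar zbar /\
  exists mu r1 r2, 0 <= mu /\ 0 < r1 /\ 0 < r2 /\
    (forall z, enorm (esub z zbar) < r2 -> S ybar z -> z = zbar) /\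
    (forall y z, enorm (esub y ybar) < r1 -> enorm (esub z zbar) < r2 -> S y z ->
       enorm (esub z zbar) <= mu * enorm (esub y ybar)).

(* Main.v *)
(* The proof is by contradiction, blowing up a sequence of perturbed KKT triples.  Both kinds of
   perturbation give A in K and Y' in N_K(A) at distance at most |delta| from G(x) and Y.  If the
   error bound fails, the normalized differences converge along a subsequence to some
   (xi, eta, zeta) <> 0 satisfying the linearized KKT system; xi is critical.  The SRCQ makes the
   multiplier unique, so the SOSC at xi <> 0 would give
     - <zeta, G'xi> = <xi, L'' xi> > sigma(Y, T^2_K(G, G'xi)),
   whereas testing Y' in N_K(A) along the arcs below gives the opposite inequality; and at xi = 0
   the SRCQ forces eta = zeta = 0.

   The only geometric input on K is second-order: along every tangent direction D of K at A there
   is an arc in K whose second-order coefficient w in T^2_K(A, D) satisfies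
     - 2 <Y, D'> >= t (- <Y, w> - o(1))   whenever A + t D' is in K and D' is near D.
   It comes from the action X |-> P X Q^T of O(m) x O(n), which preserves K.  Let L be the
   generator X |-> A X - X B of a one-parameter subgroup, chosen so that X and H - L X have a
   simultaneous singular value decomposition.  Then the Ky Fan norm is affine on
   X + t (H - L X) for small t >= 0; rotating this segment gives the arc, and rotating a nearby
   point of K backwards gives the inequality.  Simultaneous decompositions are obtained by
   maximizing a Brockett function sum_l c_l (U^T X V)_ll, first over O(m) x O(n), then over
   the stabilizer of the diagonal form. *)

Require Import Defs.
From mathcomp Require Import Rstruct.
From mathcomp Require Import all_algebra all_fingroup.
From Stdlib Require Import Lra Psatz FunctionalExtensionality Lia Classical.
Import GRing.Theory.

Set Implicit Arguments.
Unset Strict Implicit.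

(** * Real sequences *)

Lemma rsum_scal (I : finType) (a : R) (F : I -> R) :
  \big[Rplus/0]_i (a * F i) = a * \big[Rplus/0]_i F i.
Proof. by rewrite big_distrr. Qed.

Lemma rsum_add (I : finType) (F G : I -> R) :
  \big[Rplus/0]_i (F i + G i) = \big[Rplus/0]_i F i + \big[Rplus/0]_i G i.
Proof. exact: big_split. Qed.

Lemma rsum_le (I : finType) (P : pred I) (F G : I -> R) :
  (forall i, P i -> F i <= G i) ->
  \big[Rplus/0]_(i | P i) F i <= \big[Rplus/0]_(i | P i) G i.
Proof. by move=> le; elim/big_rec2: _ => [|i x y Pi IH]; [lra|have := le i Pi; lra]. Qed.

Lemma rsum_ge0 (I : finType) (P : pred I) (F : I -> R) :
  (forall i, P i -> 0 <= F i) -> 0 <= \big[Rplus/0]_(i | P i) F i.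
Proof. by move=> le; elim/big_rec: _ => [|i x Pi IH]; [lra|have := le i Pi; lra]. Qed.

Lemma rsum_term_le (I : finType) (F : I -> R) j :
  (forall i, 0 <= F i) -> F j <= \big[Rplus/0]_i F i.
Proof.
move=> F0; rewrite (bigD1 j) //=.
by have := @rsum_ge0 I (fun i => i != j) F (fun i _ => F0 i); lra.
Qed.

Lemma cv_unique u l l' : Un_cv u l -> Un_cv u l' -> l = l'.
Proof. exact: UL_sequence. Qed.

Lemma cv_ext u v l : (forall n, u n = v n) -> Un_cv u l -> Un_cv v l.
Proof. by move=> e; have -> : v = u by apply: functional_extensionality => n; rewrite e. Qed.

Lemma cv_const c : Un_cv (fun _ => c) c.
Proof. by move=> e e0; exists 0%nat => n _; rewrite /R_dist Rminus_diag Rabs_R0. Qed.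

Lemma cv_add u v l l' : Un_cv u l -> Un_cv v l' -> Un_cv (fun n => u n + v n) (l + l').
Proof. exact: CV_plus. Qed.

Lemma cv_mul u v l l' : Un_cv u l -> Un_cv v l' -> Un_cv (fun n => u n * v n) (l * l').
Proof. exact: CV_mult. Qed.

Lemma cv_scal a u l : Un_cv u l -> Un_cv (fun n => a * u n) (a * l).
Proof. by move=> H; apply: cv_mul => //; apply: cv_const. Qed.

Lemma cv_sum (I : finType) (F : nat -> I -> R) (l : I -> R) :
  (forall i, Un_cv (fun n => F n i) (l i)) ->
  Un_cv (fun n => \big[Rplus/0]_i F n i) (\big[Rplus/0]_i l i).
Proof.
move=> H; elim: (index_enum I) => [|i s IH].
  by rewrite big_nil; apply: cv_ext (cv_const 0) => n; rewrite big_nil.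
rewrite big_cons; apply: cv_ext (cv_add (H i) IH) => n; by rewrite big_cons.
Qed.

Lemma cv_abs u l : Un_cv u l -> Un_cv (fun n => Rabs (u n)) (Rabs l).
Proof. exact: cv_cvabs. Qed.

Lemma cv_sandwich0 u v : (forall n, 0 <= u n <= v n) -> Un_cv v 0 -> Un_cv u 0.
Proof.
move=> H Hv e e0; have [N HN] := Hv e e0; exists N => n Hn.
have := HN n Hn; have := H n; rewrite /R_dist !Rminus_0_r => h.
rewrite !Rabs_pos_eq; lra.
Qed.

Lemma cv_le u v l l' N : (forall n, (N <= n)%coq_nat -> u n <= v n) ->
  Un_cv u l -> Un_cv v l' -> l <= l'.
Proof.
move=> H Hu Hv; apply: Rnot_lt_le => ll.
have e0 : 0 < (l - l') / 2 by lra.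
have [N1 H1] := Hu _ e0; have [N2 H2] := Hv _ e0.
set n := Nat.max N (Nat.max N1 N2).
have := H n ltac:(rewrite /n; lia).
have := H1 n ltac:(rewrite /n; lia); have := H2 n ltac:(rewrite /n; lia).
rewrite /R_dist => /Rabs_def2 ? /Rabs_def2 ?; lra.
Qed.

Lemma cv_inv_succ : Un_cv (fun n => / (INR n + 1)) 0.
Proof.
move=> e e0; have [N [HN N0]] := archimed_cor1 e e0; exists N => n Hn.
rewrite /R_dist Rminus_0_r Rabs_pos_eq; last first.
  by apply: Rlt_le; apply: Rinv_0_lt_compat; have := pos_INR n; lra.
apply: Rle_lt_trans HN; apply: Rinv_le_contravar; first exact: (lt_INR 0).
by have := le_INR _ _ Hn; lra.
Qed.

(** * Subsequences and compactness of bounded sequences *)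

Definition extraction (phi : nat -> nat) := forall n, (phi n < phi (S n))%coq_nat.

Lemma extraction_ge phi n : extraction phi -> (n <= phi n)%coq_nat.
Proof. by move=> H; elim: n => [|n IH]; [lia|have := H n; lia]. Qed.

Lemma extraction_mono phi n k : extraction phi -> (n < k)%coq_nat -> (phi n < phi k)%coq_nat.
Proof. by move=> H; elim=> [|k' le IH]; [exact: H|have := H k'; lia]. Qed.

Lemma extraction_comp phi psi : extraction phi -> extraction psi ->
  extraction (fun n => phi (psi n)).
Proof. by move=> H1 H2 n; apply: extraction_mono. Qed.

Lemma cv_extract phi u l : extraction phi -> Un_cv u l -> Un_cv (fun n => u (phi n)) l.
Proof.
move=> H Hu e e0; have [N HN] := Hu e e0; exists N => n Hn; apply: HN.
have := @extraction_ge phi n H; lia.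
Qed.

Lemma functional_choice (S T : Type) (P : S -> T -> Prop) :
  (forall x, exists y, P x y) -> exists g, forall x, P x (g x).
Proof.
move=> H; exists (fun x => proj1_sig (constructive_indefinite_description _ (H x))).
by move=> x; case: constructive_indefinite_description.
Qed.

Lemma bolzano_weierstrass_real (u : nat -> R) M : (forall n, Rabs (u n) <= M) ->
  exists phi l, extraction phi /\ Un_cv (fun n => u (phi n)) l.
Proof.
move=> H.
have [l Hl] := @Bolzano_Weierstrass u (fun c => -M <= c <= M) (compact_P3 _ _)
  (fun n => ltac:(have := H n; rewrite /Rabs; case: Rcase_abs; lra)).
have step N j : exists p, (N < p)%coq_nat /\ Rabs (u p - l) < / (INR j + 1).
  have j0 : 0 < / (INR j + 1) by apply: Rinv_0_lt_compat; have := pos_INR j; lra.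
  have [p [Hp1 Hp2]] := Hl (disc l (mkposreal _ j0)) (S N)
    (ex_intro _ (mkposreal _ j0) (fun x H => H)).
  by exists p; split; [lia|exact: Hp2].
have [g Hg] := functional_choice (fun N => functional_choice (step N)).
(* Each index is taken beyond the previous one, the n-th within 1/(n+1) of the cluster point [l]. *)
pose phi := fix phi n := match n with O => g O O | S n' => g (phi n') (S n') end.
exists phi, l; split=> [n|e e0]; first by case: (Hg (phi n) (S n)).
have [N HN] := archimed_cor1 e e0; exists N => n Hn.
have : Rabs (u (phi n) - l) < / (INR n + 1) by case: n Hn => [|n] _; apply Hg.
rewrite /R_dist => h; apply: Rlt_trans h _; case: HN => HN N0.
apply: Rle_lt_trans HN; apply: Rinv_le_contravar; first exact: (lt_INR 0).
have := le_INR _ _ Hn; lra.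
Qed.

Lemma bolzano_weierstrass (I : finType) (u : nat -> I -> R) M :
  (forall n i, Rabs (u n i) <= M) ->
  exists phi l, extraction phi /\ forall i : I, Un_cv (fun n => u (phi n) i) (l i).
Proof.
move=> H.
suff [phi [l [Hphi Hl]]] : exists phi l, extraction phi /\
    forall i, i \in index_enum I -> Un_cv (fun n => u (phi n) i) (l i).
  by exists phi, l; split=> // i; apply: Hl; rewrite mem_index_enum.
(* Coordinates are treated one at a time; a further extraction keeps the limits already obtained. *)
elim: (index_enum I) => [|j s [phi [l [Hphi Hl]]]].
  by exists id, (fun _ => 0); split=> // n; rewrite /id; lia.
have [psi [a [Hpsi Ha]]] := @bolzano_weierstrass_real (fun n => u (phi n) j) M (fun n => H _ _).
exists (fun n => phi (psi n)), (fun i => if i == j then a else l i).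
split; first exact: extraction_comp.
move=> i; rewrite inE; case: eqP => [-> _|_ /= Hi]; first exact: Ha.
exact: cv_extract (Hl i Hi).
Qed.

(** * Euclidean spaces with coordinates *)

(** [ESpace] is bare data without axioms. An isometry with a finite coordinate space supplies all
    vector and inner-product laws at once, turns vector identities into scalar ones for [ring], and
    makes convergence and compactness coordinatewise. *)
Structure cspace := CSpace {
  sp :> ESpace;
  idx : finType;
  co : sp -> idx -> R;
  uco : (idx -> R) -> sp;
  ucoK : forall a, co (uco a) = a;
  coK : forall u, uco (co u) = u;
  co0 : forall i, co ezero i = 0;
  coD : forall u v i, co (eadd u v) i = co u i + co v i;
  coZ : forall a u i, co (escal a u) i = a * co u i;
  ip_co : forall u v, eip u v = \big[Rplus/0]_i (co u i * co v i) }.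

Canonical coords_R : cspace.
Proof.
refine (@CSpace RSp unit (fun u _ => u) (fun a => a tt) _ _ _ _ _ _) => //.
- by move=> a; apply: functional_extensionality; case.
- by move=> u v; rewrite (big_pred1 tt); last by case.
Defined.

Definition MatSp (m n : nat) : ESpace :=
  {| car := Mat m n; ezero := fun _ _ => 0;
     eadd := fun u v i j => u i j + v i j;
     escal := fun a u i j => a * u i j; eip := matip m n |}.

Canonical coords_Rv (p : nat) : cspace.
Proof. by refine (@CSpace (RvSp p) 'I_p (fun u i => u i) (fun a => a) _ _ _ _ _ _). Defined.

Canonical coords_Mat (m n : nat) : cspace.
Proof.
refine (@CSpace (MatSp m n) ('I_m * 'I_n)%type (fun u i => u i.1 i.2)
  (fun a i j => a (i, j)) _ _ _ _ _ _) => //.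
- by move=> a; apply: functional_extensionality; case.
- by move=> u v; rewrite /= /matip pair_big.
Defined.

Canonical coords_prod (E F : cspace) : cspace.
Proof.
refine (@CSpace (prodSp E F) (idx E + idx F)%type
  (fun u i => match i with inl i => co u.1 i | inr j => co u.2 j end)
  (fun a => (uco (fun i => a (inl i)), uco (fun j => a (inr j)))) _ _ _ _ _ _) => //=.
- by move=> a; apply: functional_extensionality => -[i|i]; rewrite ucoK.
- by move=> [u v]; rewrite /= !coK.
- by case=> i; rewrite co0.
- by move=> u v [i|i]; rewrite coD.
- by move=> a u [i|i]; rewrite coZ.
- move=> u v; rewrite !ip_co big_sumType //.
Defined.

(** [XSp] is declared on its own, but its operations are convertible to those of the product of
    [RSp] and [MatSp], so the fields of the product structure are reused. *)
Canonical coords_X (m n : nat) : cspace :=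
  let c := coords_prod coords_R (coords_Mat m n) in
  @CSpace (XSp m n) (idx c) (@co c) (@uco c) (@ucoK c) (@coK c) (@co0 c) (@coD c) (@coZ c)
    (@ip_co c).

Lemma co_inj (E : cspace) (u v : E) : (forall i, co u i = co v i) -> u = v.
Proof.
by move=> H; rewrite -[u]coK -[v]coK; congr uco; apply: functional_extensionality.
Qed.

Lemma coB (E : cspace) (u v : E) i : co (esub u v) i = co u i - co v i.
Proof. rewrite /esub coD coZ; ring. Qed.

Ltac evec := apply: co_inj => ?; rewrite ?(coB, coD, coZ, co0).

Section Euclid.
Context {E : cspace}.
Implicit Types u v w : E.

Lemma eipC u v : eip u v = eip v u.
Proof. by rewrite !ip_co; apply: eq_bigr => i _; ring. Qed.

Lemma eipDl u v w : eip (eadd u v) w = eip u w + eip v w.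
Proof. by rewrite !ip_co -rsum_add; apply: eq_bigr => i _; rewrite coD; ring. Qed.

Lemma eipZl a u w : eip (escal a u) w = a * eip u w.
Proof. by rewrite !ip_co -rsum_scal; apply: eq_bigr => i _; rewrite coZ; ring. Qed.

Lemma eipDr u v w : eip w (eadd u v) = eip w u + eip w v.
Proof. by rewrite eipC eipDl !(eipC w). Qed.

Lemma eipZr a u w : eip w (escal a u) = a * eip w u.
Proof. by rewrite eipC eipZl (eipC w). Qed.

Lemma eipBl u v w : eip (esub u v) w = eip u w - eip v w.
Proof. rewrite /esub eipDl eipZl; ring. Qed.

Lemma eipBr u v w : eip w (esub u v) = eip w u - eip w v.
Proof. rewrite /esub eipDr eipZr; ring. Qed.

Lemma eip0l w : eip ezero w = 0.
Proof. by rewrite ip_co big1 // => i _; rewrite co0; ring. Qed.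

Lemma eip0r w : eip w ezero = 0.
Proof. by rewrite eipC eip0l. Qed.

Definition eipE := (eipDl, eipDr, eipZl, eipZr, eipBl, eipBr, eip0l, eip0r).

Lemma eip_ge0 u : 0 <= eip u u.
Proof. by rewrite ip_co; apply: rsum_ge0 => i _; nra. Qed.

Lemma enorm_ge0 u : 0 <= enorm u.
Proof. exact: sqrt_pos. Qed.

Lemma enorm_sq u : enorm u * enorm u = eip u u.
Proof. by rewrite /enorm sqrt_sqrt //; apply: eip_ge0. Qed.

Lemma co_le_norm u i : Rabs (co u i) <= enorm u.
Proof.
rewrite -sqrt_Rsqr_abs; apply: sqrt_le_1_alt; rewrite ip_co.
by apply: (@rsum_term_le _ (fun i => co u i * co u i)) => j; nra.
Qed.

Lemma norm_eq0 u : enorm u = 0 -> u = ezero.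
Proof.
by move=> H; apply: co_inj => i; have := co_le_norm u i; rewrite H co0 /Rabs; case: Rcase_abs; lra.
Qed.

Lemma eip_eq0 u : eip u u <= 0 -> u = ezero.
Proof.
by move=> H; apply: norm_eq0; have := enorm_sq u; have := enorm_ge0 u; nra.
Qed.

Lemma enorm0 : enorm (ezero : E) = 0.
Proof. by rewrite /enorm eip0l sqrt_0. Qed.

Lemma enorm_scal a u : enorm (escal a u) = Rabs a * enorm u.
Proof.
rewrite /enorm eipZl eipZr -Rmult_assoc sqrt_mult_alt; last nra.
by rewrite (_ : a * a = Rsqr a) // sqrt_Rsqr_abs.
Qed.

Lemma cauchy_schwarz u v : Rabs (eip u v) <= enorm u * enorm v.
Proof.
have H a b : 0 <= a * a * eip u u + 2 * a * b * eip u v + b * b * eip v v.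
  have := eip_ge0 (eadd (escal a u) (escal b v)); rewrite !eipE (eipC v u); lra.
(* These choices give <v,v> (<u,u><v,v> - <u,v>^2) >= 0 and its mirror image. If both squared norms
   vanish, the coefficients (1, 1) and (1, -1) force <u,v> = 0. *)
have H1 := H (eip v v) (- eip u v).
have H2 := H (- eip u v) (eip u u).
have u0 := eip_ge0 u; have v0 := eip_ge0 v.
have D : eip u v * eip u v <= eip u u * eip v v.
  case: (Req_dec (eip v v) 0) => [e|]; last by move=> ?; nra.
  case: (Req_dec (eip u u) 0) => [e'|]; last by move=> ?; nra.
  have := H 1 1; have := H 1 (-1); rewrite e e'; nra.
rewrite -(Rabs_pos_eq (enorm u * enorm v)); last first.
  by apply: Rmult_le_pos; apply: enorm_ge0.
apply: Rsqr_le_abs_0; rewrite /Rsqr.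
have := enorm_sq u; have := enorm_sq v; nra.
Qed.

Lemma eip_le u v : eip u v <= enorm u * enorm v.
Proof. exact: Rle_trans (Rle_abs _) (cauchy_schwarz u v). Qed.

Lemma enorm_tri u v : enorm (eadd u v) <= enorm u + enorm v.
Proof.
have := enorm_sq (eadd u v); rewrite !eipE (eipC v u) -!enorm_sq.
have := eip_le u v; have := enorm_ge0 u; have := enorm_ge0 v; have := enorm_ge0 (eadd u v).
nra.
Qed.

Lemma norm_le_co u : enorm u <= \big[Rplus/0]_i Rabs (co u i).
Proof.
set s := (X in _ <= X).
have s0 : 0 <= s by apply: rsum_ge0 => i _; apply: Rabs_pos.
have : eip u u <= s * s.
  rewrite ip_co /s -rsum_scal; apply: rsum_le => i _.
  have := @rsum_term_le _ (fun i => Rabs (co u i)) i (fun i => Rabs_pos _).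
  have := Rabs_pos (co u i).
  have -> : co u i * co u i = Rabs (co u i) * Rabs (co u i).
    by rewrite -Rabs_mult Rabs_pos_eq //; nra.
  rewrite -/s; nra.
rewrite -enorm_sq; have := enorm_ge0 u; nra.
Qed.

Lemma esub_eq0 u v : esub u v = ezero -> u = v.
Proof.
move=> H; apply: co_inj => i; have : co (esub u v) i = co ezero i by rewrite H.
by rewrite coB co0; lra.
Qed.

Lemma esub0 u : esub u ezero = u.
Proof. by evec; ring. Qed.

Lemma esubxx u : esub u u = ezero.
Proof. by evec; ring. Qed.

Lemma enorm_subC u v : enorm (esub u v) = enorm (esub v u).
Proof.
have -> : esub u v = escal (-1) (esub v u) by evec; ring.
by rewrite enorm_scal Rabs_Ropp Rabs_R1; ring.
Qed.

Definition ecv (x : nat -> E) (l : E) := forall i, Un_cv (fun n => co (x n) i) (co l i).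

Lemma ecv_norm x l : ecv x l -> Un_cv (fun n => enorm (esub (x n) l)) 0.
Proof.
move=> H; apply: (@cv_sandwich0 _ (fun n => \big[Rplus/0]_i Rabs (co (esub (x n) l) i))).
  by move=> n; split; [apply: enorm_ge0|apply: norm_le_co].
suff H0 (i : idx E) : Un_cv (fun n => Rabs (co (esub (x n) l) i)) 0.
  by have := cv_sum H0; rewrite big1.
rewrite -Rabs_R0 -(Rplus_opp_r (co l i)); apply: cv_abs.
by apply: cv_ext (cv_add (H i) (cv_const _)) => n; rewrite coB.
Qed.

Lemma ecv_of_norm x l : Un_cv (fun n => enorm (esub (x n) l)) 0 -> ecv x l.
Proof.
move=> H i e e0; have [N HN] := H e e0; exists N => n Hn.
have := HN n Hn; rewrite /R_dist Rminus_0_r Rabs_pos_eq; last exact: enorm_ge0.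
by apply: Rle_lt_trans; rewrite -coB; apply: co_le_norm.
Qed.

Lemma ecv_near x l e : ecv x l -> 0 < e ->
  exists N, forall n, (N <= n)%coq_nat -> enorm (esub (x n) l) < e.
Proof.
move=> /ecv_norm H e0; have [N HN] := H e e0; exists N => n Hn.
have := HN n Hn; rewrite /R_dist Rminus_0_r Rabs_pos_eq //; exact: enorm_ge0.
Qed.

Lemma ecv_ext x y l : (forall n, x n = y n) -> ecv x l -> ecv y l.
Proof. by move=> e H i; apply: cv_ext (H i) => n; rewrite e. Qed.

Lemma ecv_unique x l l' : ecv x l -> ecv x l' -> l = l'.
Proof. by move=> H H'; apply: co_inj => i; apply: cv_unique (H i) (H' i). Qed.

Lemma ecv_const l : ecv (fun _ => l) l.
Proof. by move=> i; apply: cv_const. Qed.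

Lemma ecv_add x y l l' : ecv x l -> ecv y l' -> ecv (fun n => eadd (x n) (y n)) (eadd l l').
Proof.
by move=> H H' i; rewrite coD; apply: cv_ext (cv_add (H i) (H' i)) => n; rewrite coD.
Qed.

Lemma ecv_scal a b x l : Un_cv a b -> ecv x l -> ecv (fun n => escal (a n) (x n)) (escal b l).
Proof.
by move=> H H' i; rewrite coZ; apply: cv_ext (cv_mul H (H' i)) => n; rewrite coZ.
Qed.

Lemma ecv_sub x y l l' : ecv x l -> ecv y l' -> ecv (fun n => esub (x n) (y n)) (esub l l').
Proof. by move=> H H'; apply: ecv_add => //; apply: ecv_scal => //; apply: cv_const. Qed.

Lemma ecv_ip x y l l' : ecv x l -> ecv y l' -> Un_cv (fun n => eip (x n) (y n)) (eip l l').
Proof.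
move=> H H'; rewrite ip_co; apply: cv_ext (cv_sum (fun i => cv_mul (H i) (H' i))) => n.
by rewrite ip_co.
Qed.

Lemma ecv_enorm x l : ecv x l -> Un_cv (fun n => enorm (x n)) (enorm l).
Proof.
move=> /ecv_norm H e e0; have [N HN] := H e e0; exists N => n Hn.
have := HN n Hn; rewrite /R_dist Rminus_0_r Rabs_pos_eq; last exact: enorm_ge0.
apply: Rle_lt_trans.
have := enorm_tri (esub (x n) l) l; have := enorm_tri (esub l (x n)) (x n).
have -> : eadd (esub (x n) l) l = x n by evec; ring.
have -> : eadd (esub l (x n)) (x n) = l by evec; ring.
by rewrite (enorm_subC l) => ? ?; apply: Rabs_le; lra.
Qed.

Lemma ecv_bolzano (x : nat -> E) M : (forall n, enorm (x n) <= M) ->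
  exists phi l, extraction phi /\ ecv (fun n => x (phi n)) l.
Proof.
move=> H; have [|phi [l [Hphi Hl]]] := @bolzano_weierstrass (idx E) (fun n => co (x n)) M.
  by move=> n i; apply: Rle_trans (co_le_norm _ _) (H n).
by exists phi, (uco l); split=> // i; rewrite ucoK.
Qed.

Definition ebasis (i : idx E) : E := uco (fun j => if j == i then 1 else 0).

Lemma linear_riesz (phi : E -> RSp) : is_linear phi ->
  forall u, phi u = \big[Rplus/0]_i (co u i * phi (ebasis i)).
Proof.
move=> [HD HZ] u; have phi0 : phi ezero = 0.
  have -> : ezero = escal 0 ezero :> E by evec; ring.
  by rewrite HZ /=; ring.
(* Induction on the support: the vector truncated to the indices in [s] grows by one basis term at a
   time. *)
suff H s : uniq s -> phi (uco (fun i => if i \in s then co u i else 0)) =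
    \big[Rplus/0]_(i <- s) (co u i * phi (ebasis i)).
  rewrite -H ?index_enum_uniq //; congr phi; apply: co_inj => i.
  by rewrite ucoK mem_index_enum.
elim: s => [_|j s IH /= /andP[js us]].
  rewrite big_nil -[RHS]phi0; congr phi; apply: co_inj => i; by rewrite ucoK co0.
rewrite big_cons -IH //.
set v := uco _; set w := uco (fun i => if i \in s then _ else _).
transitivity (phi (eadd (escal (co u j) (ebasis j)) w)); last by rewrite HD HZ.
congr phi; apply: co_inj => i; rewrite /v /w.
rewrite coD coZ !ucoK inE; case: eqP => [->|_] /=; last by ring.
by rewrite (negbTE js); ring.
Qed.

End Euclid.

Lemma ecv_linear (E F : cspace) (L : E -> F) x l :
  is_linear L -> ecv x l -> ecv (fun n => L (x n)) (L l).
Proof.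
move=> [HD HZ] H j.
have Hl : is_linear ((fun u => co (L u) j) : E -> RSp).
  by split=> *; rewrite ?HD ?HZ ?coD ?coZ.
rewrite (linear_riesz Hl).
apply: cv_ext (cv_sum (fun i => cv_mul (H i) (cv_const (co (L (ebasis i)) j)))) => n.
by rewrite (linear_riesz Hl (x n)).
Qed.

Lemma linear0 (E F : cspace) (L : E -> F) :
  is_linear L -> L ezero = ezero.
Proof.
move=> [_ H]; have -> : ezero = escal 0 ezero :> E by evec; ring.
by rewrite H; evec; ring.
Qed.

Lemma ecv_pair (E F : cspace) (x : nat -> prodSp E F) l :
  ecv x l -> ecv (fun n => (x n).1) l.1 /\ ecv (fun n => (x n).2) l.2.
Proof.
move=> H; split.
- by move=> i; apply: (H (inl i)).
- by move=> i; apply: (H (inr i)).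
Qed.

Lemma enorm_fst (E F : cspace) (z : prodSp E F) : enorm z.1 <= enorm z.
Proof.
apply: sqrt_le_1_alt; have := eip_ge0 z.2.
have -> : eip z z = eip z.1 z.1 + eip z.2 z.2 by []; lra.
Qed.

Lemma enorm_snd (E F : cspace) (z : prodSp E F) : enorm z.2 <= enorm z.
Proof.
apply: sqrt_le_1_alt; have := eip_ge0 z.1.
have -> : eip z z = eip z.1 z.1 + eip z.2 z.2 by []; lra.
Qed.

(** * Second-order behaviour of normal vectors to a cone *)

Definition is_cone (E : ESpace) (K : E -> Prop) := forall z a, K z -> 0 <= a -> K (escal a z).

(** The second clause says that [w] asymptotically maximizes <Y, .> among second-order terms: for
    <Y,D> = 0 and D' = D + (t/2) w' it reads <Y,w'> <= <Y,w> + eps. Stating it through D' assumes no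
    rate of convergence of D' to D. *)
Definition parabolically_regular (E : ESpace) (K : E -> Prop) (A Y : E) :=
  forall D, tangent_cone K A D -> exists w, tangent2 K A D w /\
    forall eps, 0 < eps -> exists del, 0 < del /\
    forall t D', 0 < t < del -> enorm (esub D' D) < del -> K (eadd A (escal t D')) ->
    t * (- eip Y w - eps) <= -2 * eip Y D'.

(** Convergence of difference quotients along the steps [t n]. It serves as a sequential derivative
    at [u0], with a chain rule [dcv_deriv] and a product rule [dcv_ip]. *)
Definition dcv (E : cspace) (t : nat -> R) (u : nat -> E) (u0 D : E) :=
  ecv (fun n => escal (/ t n) (esub (u n) u0)) D.

Section Quotients.
Context (t : nat -> R) (t0 : forall n, 0 < t n) (tcv : Un_cv t 0).

Lemma dcv_expand (E : cspace) (u : nat -> E) u0 n :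
  u n = eadd u0 (escal (t n) (escal (/ t n) (esub (u n) u0))).
Proof. by evec; have := t0 n => ?; field; lra. Qed.

Lemma dcv_ecv (E : cspace) (u : nat -> E) u0 D : dcv t u u0 D -> ecv u u0.
Proof.
move=> Hu; have -> : u0 = eadd u0 (escal 0 D) by evec; ring.
apply: ecv_ext (ecv_add (ecv_const u0) (ecv_scal tcv Hu)) => n /=.
by rewrite -(dcv_expand u u0 n).
Qed.

Lemma dcv_deriv (E F : cspace) (g : E -> F) Dg u u0 D : has_deriv g Dg ->
  dcv t u u0 D -> dcv t (fun n => g (u n)) (g u0) (Dg u0 D).
Proof.
move=> /(_ u0) [Lin Hg] Hu.
set q := fun n => escal (/ t n) (esub (u n) u0).
pose r n := escal (/ t n) (esub (esub (g (u n)) (g u0)) (Dg u0 (esub (u n) u0))).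
have Hr : ecv r ezero.
  apply: ecv_of_norm => e e0.
  have D0 := enorm_ge0 D.
  (* The quotients eventually have norm below |D| + 1, so this tolerance in the definition of the
     derivative leaves an error below [e]. *)
  have e'0 : 0 < e / (enorm D + 1) by apply: Rdiv_lt_0_compat; lra.
  have [del [del0 Hdel]] := Hg _ e'0.
  have [N1 H1] := ecv_near (dcv_ecv Hu) del0.
  have [N2 H2] := ecv_near Hu Rlt_0_1.
  exists (Nat.max N1 N2) => n Hn.
  have {}H1 := H1 n ltac:(lia); have {}H2 := H2 n ltac:(lia).
  rewrite /R_dist Rminus_0_r Rabs_pos_eq; last exact: enorm_ge0.
  have -> : esub (r n) ezero = r n by evec; ring.
  rewrite /r enorm_scal.
  have tn := t0 n; have itn : 0 < / t n by apply: Rinv_0_lt_compat.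
  rewrite (Rabs_pos_eq (/ t n)); last lra.
  have -> : g (u n) = g (eadd u0 (esub (u n) u0)) by congr g; evec; ring.
  have Hd := Hdel _ H1.
  have qn : enorm (q n) = / t n * enorm (esub (u n) u0).
    by rewrite /q enorm_scal Rabs_pos_eq //; lra.
  have qD : enorm (q n) < enorm D + 1.
    have -> : q n = eadd (esub (q n) D) D by evec; ring.
    by have := enorm_tri (esub (q n) D) D; rewrite /q; lra.
  apply: (@Rle_lt_trans _ (e / (enorm D + 1) * enorm (q n))).
    rewrite qn; have := Rmult_le_compat_l (/ t n) _ _ ltac:(lra) Hd; lra.
  apply: (@Rlt_le_trans _ (e / (enorm D + 1) * (enorm D + 1))); last by right; field; lra.
  by apply: Rmult_lt_compat_l.
have -> : Dg u0 D = eadd ezero (Dg u0 D) by evec; ring.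
apply: ecv_ext (ecv_add Hr (ecv_linear Lin Hu)) => n.
by rewrite /r (proj2 Lin); evec; ring.
Qed.

Lemma dcv_ip (E : cspace) (u v : nat -> E) u0 v0 D D' : dcv t u u0 D -> dcv t v v0 D' ->
  Un_cv (fun n => / t n * (eip (u n) (v n) - eip u0 v0)) (eip D v0 + eip u0 D').
Proof.
move=> Hu Hv.
have H1 := ecv_ip Hu (dcv_ecv Hv); have H2 := ecv_ip (ecv_const u0) Hv.
apply: cv_ext (cv_add H1 H2) => n; rewrite !eipE; ring.
Qed.

Lemma dcv_near0 (E : cspace) (u v : nat -> E) u0 D :
  dcv t u u0 D -> Un_cv (fun n => / t n * enorm (esub (v n) (u n))) 0 -> dcv t v u0 D.
Proof.
move=> Hu Hv.
have H : ecv (fun n => escal (/ t n) (esub (v n) (u n))) ezero.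
  apply: ecv_of_norm; apply: cv_ext Hv => n.
  have -> : esub (escal (/ t n) (esub (v n) (u n))) ezero = escal (/ t n) (esub (v n) (u n)).
    by evec; ring.
  rewrite enorm_scal Rabs_pos_eq //; have := Rinv_0_lt_compat _ (t0 n); lra.
have -> : D = eadd D ezero by evec; ring.
by apply: ecv_ext (ecv_add Hu H) => n; evec; ring.
Qed.

End Quotients.

Section Cone.
Context (E : cspace) (K : E -> Prop) (coneK : is_cone K).

(** The test points 2A and 0 of the cone give <Y,A> <= 0 and <Y,A> >= 0; with the product zero,
    normality at A becomes membership in the polar cone. *)
Lemma normal_cone_polar A Y : K A -> normal_cone K A Y ->
  eip Y A = 0 /\ forall z, K z -> eip Y z <= 0.
Proof.
move=> KA NY.
have h2 := NY _ (coneK KA (ltac:(lra) : 0 <= 2)).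
have h0 := NY _ (coneK KA (Rle_refl 0)).
have YA : eip Y A = 0 by move: h2 h0; rewrite !eipE; lra.
by split=> // z Kz; have := NY _ Kz; rewrite !eipE; lra.
Qed.

(* The normality of Y' n at A n is tested against the second-order arc through A0 in direction D1,
   run at speed c relative to the sequence. *)
Lemma normal_sequence_ineq t A Y' A0 Y0 D zeta D1 w b c :
  (forall n, 0 < t n) -> Un_cv t 0 -> K A0 -> normal_cone K A0 Y0 ->
  dcv t A A0 D -> dcv t Y' Y0 zeta ->
  (forall n, K (A n)) -> (forall n, normal_cone K (A n) (Y' n)) ->
  tangent2 K A0 D1 w -> eip Y0 D1 = 0 ->
  (exists N, forall n, (N <= n)%coq_nat -> t n * b <= - eip Y0 (escal (/ t n) (esub (A n) A0))) ->
  0 < c ->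
  b - eip zeta D + c * eip zeta D1 + c * c / 2 * eip Y0 w <= 0.
Proof.
move=> t0 tcv KA0 NY0 HA HY KA NY HT YD1 [Nb Hb] c0.
have [YA0 _] := normal_cone_polar KA0 NY0.
set L := (X in X <= 0).
(* The arc at parameter s = c t_n is only within eps s^2 of [K]; after division by t_n^2 this leaves
   the error |Y0| eps c^2. *)
suff Heps eps : 0 < eps -> L <= enorm Y0 * eps * (c * c).
  apply: Rnot_lt_le => L0.
  have Y0n := enorm_ge0 Y0.
  have cc : 0 < c * c by nra.
  have e0 : 0 < L / (2 * (enorm Y0 + 1) * (c * c)) by apply: Rdiv_lt_0_compat; nra.
  have := Heps _ e0.
  have -> : enorm Y0 * (L / (2 * (enorm Y0 + 1) * (c * c))) * (c * c) =
            L * (enorm Y0 / (2 * (enorm Y0 + 1))) by field; lra.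
  have : enorm Y0 / (2 * (enorm Y0 + 1)) <= / 2.
    apply: (Rmult_le_reg_r (2 * (enorm Y0 + 1))); first lra.
    by rewrite /Rdiv Rmult_assoc Rinv_l; lra.
  nra.
move=> eps0.
have [T [T0 HTT]] := HT eps eps0.
pose q n := escal (/ t n) (esub (Y' n) Y0).
pose d n := escal (/ t n) (esub (A n) A0).
have Hq : ecv q zeta := HY; have Hd : ecv d D := HA.
have cT : 0 < T / c by apply: Rdiv_lt_0_compat.
have [N1 H1] := tcv _ cT.
apply: (@cv_le
  (fun n => b - eip (q n) (d n) + c * eip (q n) D1 + c * c / 2 * (eip Y0 w + t n * eip (q n) w))
  (fun n => enorm (Y' n) * eps * (c * c)) _ _ (Nat.max N1 Nb)) => [n Hn||]; last 2 first.
- rewrite /L.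
  have -> : b - eip zeta D + c * eip zeta D1 + c * c / 2 * eip Y0 w =
    ((b + (-1) * eip zeta D) + c * eip zeta D1) + c * c / 2 * (eip Y0 w + 0 * eip zeta w) by ring.
  apply: cv_ext (cv_add (cv_add (cv_add (cv_const b) (cv_scal (-1) (ecv_ip Hq Hd)))
    (cv_scal c (ecv_ip Hq (ecv_const D1))))
    (cv_scal _ (cv_add (cv_const _) (cv_mul tcv (ecv_ip Hq (ecv_const w)))))) => n; ring.
- by do 2!(apply: cv_mul; last exact: cv_const); apply: ecv_enorm; apply: dcv_ecv HY.
have {}H1 := H1 n ltac:(lia); have {}Hb := Hb n ltac:(lia).
have tn := t0 n.
have sT : 0 < c * t n < T.
  split; first nra.
  move: H1; rewrite /R_dist Rminus_0_r Rabs_pos_eq; last lra.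
  move=> h; have := Rmult_lt_compat_l c _ _ c0 h; have -> : c * (T / c) = T by field; lra.
  by [].
have [z [Kz Hz]] := HTT _ sT.
have [YA Yle] := normal_cone_polar (KA n) (NY n).
have EY : Y' n = eadd Y0 (escal (t n) (q n)) by rewrite (dcv_expand t0 Y' Y0 n).
have EA : A n = eadd A0 (escal (t n) (d n)) by rewrite (dcv_expand t0 A A0 n).
set s := c * t n in sT Hz.
set arc := (X in esub X z) in Hz.
have Harc : eip (Y' n) arc <= enorm (Y' n) * (eps * (s * s)).
  have := Yle _ Kz; have := eip_le (Y' n) (esub arc z); rewrite eipBr.
  have := Rmult_le_compat_l _ _ _ (enorm_ge0 (Y' n)) (Rlt_le _ _ Hz).
  lra.
rewrite -/(d n) in Hb; clearbody q d.
move: YA Harc Hb; rewrite {1 2}EY EA /arc !eipE YA0 YD1 /s.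
set p := eip (q n) A0; move=> e1 e2 e3.
apply: (Rmult_le_reg_l (t n * t n)); first nra.
(* Complementarity <Y'_n, A_n> = 0 expands to <Y0,d> + p + t_n <q,d> = 0, which turns the lower
   bound [Hb] on -<Y0,d> into a lower bound on the unknown term p = <q,A0>. *)
have : t n * (t n * b - t n * eip (q n) (d n)) <= t n * p.
  apply: Rmult_le_compat_l; first lra.
  have : t n * (eip Y0 (d n) + p + t n * eip (q n) (d n)) = 0 by lra.
  by case/Rmult_integral => ?; lra.
lra.
Qed.

End Cone.

(** * Error bound for perturbed KKT points *)

Section KKT.
Context (E F H : cspace) (f : E -> RSp) (Df : E -> E -> RSp) (D2f : E -> E -> E -> RSp).
Context (h : E -> F) (Dh : E -> E -> F) (D2h : E -> E -> E -> F).
Context (G : E -> H) (DG : E -> E -> H) (D2G : E -> E -> E -> H).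
Context (Hf : C2 f Df D2f) (Hh : C2 h Dh D2h) (HG : C2 G DG D2G).
Context (K : H -> Prop) (coneK : is_cone K).

Definition lagr_grad (x : E) (lam : F) (Y : H) (d : E) : R :=
  Df x d + eip lam (Dh x d) + eip Y (DG x d).

Definition multiplier (x : E) (lam : F) (Y : H) : Prop :=
  (forall d, lagr_grad x lam Y d = 0) /\ normal_cone K (G x) Y.

Context (Xb : E) (lb : F) (Yb : H).
Context (hb : h Xb = ezero) (KGb : K (G Xb)) (HM : multiplier Xb lb Yb).
Context (regK : parabolically_regular K (G Xb) Yb).
Context (SOSCb : forall Z, Dh Xb Z = ezero -> tangent_cone K (G Xb) (DG Xb Z) -> Df Xb Z = 0 ->
  Z <> ezero -> exists lam Y, multiplier Xb lam Y /\
  support_lt Y (tangent2 K (G Xb) (DG Xb Z))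
    (D2f Xb Z Z + eip lam (D2h Xb Z Z) + eip Y (D2G Xb Z Z))).
Context (SRCQb : forall (a : F) (B : H), exists Z W,
  tangent_cone K (G Xb) W /\ eip W Yb = 0 /\ Dh Xb Z = a /\ eadd (DG Xb Z) W = B).

Lemma normal_tangent_le (A Y W : H) : normal_cone K A Y -> tangent_cone K A W -> eip Y W <= 0.
Proof.
move=> NY TW; apply: Rnot_lt_le => YW.
have Y0 := enorm_ge0 Y.
have e0 : 0 < eip Y W / (enorm Y + 1) by apply: Rdiv_lt_0_compat; lra.
have [t [t0 [d' [Hd' Kd']]]] := TW _ 1 e0 Rlt_0_1.
have := NY _ Kd'; rewrite !eipE => h1.
have : t * eip Y d' <= 0 by lra.
have : - (enorm Y * enorm (esub d' W)) <= eip Y (esub d' W).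
  by have := cauchy_schwarz Y (esub d' W); rewrite /Rabs; case: Rcase_abs; lra.
rewrite eipBr => h2 h3.
have h4 : eip Y d' <= 0 by nra.
have : enorm Y * enorm (esub d' W) <= enorm Y * (eip Y W / (enorm Y + 1)).
  by apply: Rmult_le_compat_l; lra.
have : enorm Y * (eip Y W / (enorm Y + 1)) < eip Y W.
  have -> : enorm Y * (eip Y W / (enorm Y + 1)) = eip Y W - eip Y W / (enorm Y + 1) by field; lra.
  lra.
lra.
Qed.

(** The SRCQ is solved for the right-hand side (lam - lb, Y - Yb) itself. Pairing the solution with
    this difference and using both gradient equations gives |lam - lb|^2 + |Y - Yb|^2 = <Y,W>, which
    is nonpositive because W is tangent. *)
Lemma multiplier_unique lam Y : multiplier Xb lam Y -> lam = lb /\ Y = Yb.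
Proof.
move=> [L0 NY]; have [L1 NYb] := HM.
have [Z [W [TW [WY [Ha HB]]]]] := SRCQb (esub lam lb) (esub Y Yb).
have YW := normal_tangent_le NY TW.
have := L0 Z; have := L1 Z; rewrite /lagr_grad => e1 e2.
have e3 : eip (esub lam lb) (Dh Xb Z) + eip (esub Y Yb) (DG Xb Z) = 0 by rewrite !eipBl; lra.
have e4 : eip (esub Y Yb) (esub Y Yb) = eip (esub Y Yb) (DG Xb Z) + eip Y W.
  by rewrite -{2}HB eipDr !eipBl (eipC Yb W) WY; lra.
move: e3; rewrite Ha => e3.
have := eip_ge0 (esub lam lb); have := eip_ge0 (esub Y Yb) => ? ?.
by split; apply: esub_eq0; apply: eip_eq0; lra.
Qed.

Section Sequence.
Context (t : nat -> R) (t0 : forall n, 0 < t n) (tcv : Un_cv t 0).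
Context (x : nat -> E) (lam : nat -> F) (Y A Y' : nat -> H) (xi : E) (eta : F) (zeta : H).
Context (Hx : dcv t x Xb xi) (Hlam : dcv t lam lb eta) (HY : dcv t Y Yb zeta).
Context (KA : forall n, K (A n)) (NY : forall n, normal_cone K (A n) (Y' n)).
Context (HhA : Un_cv (fun n => / t n * enorm (h (x n))) 0).
Context (HGA : Un_cv (fun n => / t n * enorm (esub (A n) (G (x n)))) 0).
Context (HYA : Un_cv (fun n => / t n * enorm (esub (Y' n) (Y n))) 0).
Context (HL : forall d, Un_cv (fun n => / t n * lagr_grad (x n) (lam n) (Y n) d) 0).

Let D := DG Xb xi.

Let HA : dcv t A (G Xb) D.
Proof. exact: (dcv_near0 t0 (dcv_deriv t0 tcv (proj1 HG) Hx) HGA). Qed.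

Let HY' : dcv t Y' Yb zeta.
Proof. exact: (dcv_near0 t0 HY HYA). Qed.

(** The Lagrangian gradient tested against [d] vanishes at the base point and is o(t) along the
    sequence; the product rule differentiates it term by term. *)
Lemma linearized_gradient d :
  D2f Xb d xi + eip lb (D2h Xb d xi) + eip Yb (D2G Xb d xi) +
  eip eta (Dh Xb d) + eip zeta (DG Xb d) = 0.
Proof.
have h1 := dcv_deriv t0 tcv (proj1 (proj2 Hf) d) Hx tt.
have h2 := dcv_ip t0 tcv Hlam (dcv_deriv t0 tcv (proj1 (proj2 Hh) d) Hx).
have h3 := dcv_ip t0 tcv HY (dcv_deriv t0 tcv (proj1 (proj2 HG) d) Hx).
suff : D2f Xb d xi + (eip eta (Dh Xb d) + eip lb (D2h Xb d xi)) +
       (eip zeta (DG Xb d) + eip Yb (D2G Xb d xi)) = 0 by lra.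
apply: cv_unique (HL d); apply: cv_ext (cv_add (cv_add h1 h2) h3) => n /=.
transitivity (/ t n * (lagr_grad (x n) (lam n) (Y n) d - lagr_grad Xb lb Yb d)).
  by rewrite /lagr_grad; ring.
by rewrite (proj1 HM d) Rminus_0_r.
Qed.

Lemma limit_tangent : tangent_cone K (G Xb) D.
Proof.
move=> eps T eps0 T0.
have [N1 H1] := ecv_near HA eps0; have [N2 H2] := tcv T0.
pose n := Nat.max N1 N2.
have {}H1 := H1 n ltac:(rewrite /n; lia); have {}H2 := H2 n ltac:(rewrite /n; lia).
exists (t n); split.
  by move: H2; rewrite /R_dist Rminus_0_r Rabs_pos_eq; have := t0 n; lra.
exists (escal (/ t n) (esub (A n) (G Xb))); split => //.
by rewrite -(dcv_expand t0 A (G Xb) n).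
Qed.

(** One inequality comes from <Yb, A_n> <= 0. The other comes from <Y'_n, A_n> = 0 together with
    <Y'_n, G(Xb)> <= 0, since Y'_n tends to Yb. *)
Lemma limit_orthogonal : eip Yb D = 0.
Proof.
have [YA0 Yle] := normal_cone_polar coneK KGb (proj2 HM).
apply: Rle_antisym.
  apply: (@cv_le _ (fun _ => 0) _ _ 0 _ (ecv_ip (ecv_const Yb) HA) (cv_const 0)) => n _.
  rewrite !eipE YA0; have := Yle _ (KA n); have := Rinv_0_lt_compat _ (t0 n); nra.
apply: (@cv_le (fun _ => 0) _ _ _ 0 _ (cv_const 0) (ecv_ip (dcv_ecv t0 tcv HY') HA)) => n _.
have [YA Yn] := normal_cone_polar coneK (KA n) (NY n).
rewrite !eipE YA; have := Yn _ KGb; have := Rinv_0_lt_compat _ (t0 n); nra.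
Qed.

Lemma limit_feasible : Dh Xb xi = ezero.
Proof.
have H1 := dcv_deriv t0 tcv (proj1 Hh) Hx.
apply: ecv_unique H1 _; apply: ecv_of_norm; apply: cv_ext HhA => n.
have -> : esub (escal (/ t n) (esub (h (x n)) (h Xb))) ezero = escal (/ t n) (h (x n)).
  by rewrite hb; evec; ring.
rewrite enorm_scal Rabs_pos_eq //; have := Rinv_0_lt_compat _ (t0 n); lra.
Qed.

Lemma limit_primal_zero : xi = ezero.
Proof.
apply: NNPP => xi0.
have dXi := limit_feasible; have YD := limit_orthogonal; have TD := limit_tangent.
have Dfxi : Df Xb xi = 0.
  by have := proj1 HM xi; rewrite /lagr_grad dXi -/D YD eip0r; lra.
have [lam1 [Y1 [M1 [r [Hr Hsup]]]]] := SOSCb dXi TD Dfxi xi0.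
(* The SOSC lets the multiplier depend on the direction; uniqueness identifies it with (lb, Yb), the
   pair for which the linearized system is available. *)
have [e1 e2] := multiplier_unique M1; subst lam1 Y1.
have := linearized_gradient xi; rewrite dXi eip0r -/D => Leq.
have [w [Tw Hw]] := regK TD.
have Yw := Hsup _ Tw.
set g := eip zeta D in Leq; set q := - eip Yb w.
have gq : g < q by rewrite /q; lra.
(* It remains to see q <= g: the inequality (1 - c^2) q / 2 <= (1 - c) g divided by 1 - c,
   with c tending to 1. *)
have main c : 0 < c < 1 -> (1 + c) / 2 * q <= g.
  move=> c01.
  suff Heps eps : 0 < eps -> (1 - c * c) / 2 * q - (1 - c) * g <= eps / 2.
    have : (1 - c) * ((1 + c) / 2 * q - g) <= 0.
      apply: Rnot_lt_le => ab; have := Heps _ ab; lra.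
    nra.
  move=> eps0; have [del [del0 Hdel]] := Hw _ eps0.
  have [N1 H1] := ecv_near HA del0; have [N2 H2] := tcv del0.
  have Hb : exists N, forall n, (N <= n)%coq_nat ->
      t n * ((q - eps) / 2) <= - eip Yb (escal (/ t n) (esub (A n) (G Xb))).
    exists (Nat.max N1 N2) => n Hn.
    have {}H1 := H1 n ltac:(lia); have {}H2 := H2 n ltac:(lia).
    have tn : 0 < t n < del.
      by move: H2; rewrite /R_dist Rminus_0_r Rabs_pos_eq; have := t0 n; lra.
    have := Hdel _ _ tn H1; rewrite -(dcv_expand t0 A (G Xb) n) => /(_ (KA n)).
    rewrite /q; lra.
  (* With D1 = D and b = (q - eps)/2 the inequality reads (1 - c^2) q / 2 - (1 - c) g <= eps / 2.
     Speed c = 1 would compare the sequence with its own leading behaviour and say nothing, hence c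
     < 1. *)
  have := normal_sequence_ineq coneK t0 tcv KGb (proj2 HM) HA HY' KA NY Tw YD Hb
    (proj1 c01).
  rewrite -/g; have -> : eip Yb w = - q by rewrite /q; ring.
  lra.
have q0 := main (/ 2) ltac:(lra).
case: (Rle_lt_dec q 0) => Hq; first by have := main (/2) ltac:(lra); nra.
have m1 : g <= q by lra.
have [c [c01 Hc]] : exists c, 0 < c < 1 /\ g < (1 + c) / 2 * q.
  (* The denominator puts c in (0, 1) and keeps the loss (1 - c) q / 2 below q - g. *)
  exists (1 - (q - g) / (2 * q + Rabs g * 2)).
  have ag := Rabs_pos g; have [ag1 ag2] : -g <= Rabs g /\ g <= Rabs g.
    by rewrite /Rabs; case: Rcase_abs; lra.
  have den : 0 < 2 * q + Rabs g * 2 by lra.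
  have r0 : 0 < (q - g) / (2 * q + Rabs g * 2) by apply: Rdiv_lt_0_compat; lra.
  have rq : (q - g) / (2 * q + Rabs g * 2) * (2 * q + Rabs g * 2) = q - g by field; lra.
  by move: r0 rq; set rr := _ / _ => r0 rq; split; nra.
have := main c c01; lra.
Qed.

(** With xi = 0 the limit direction D vanishes. Arcs in any direction W of the tangent cone
    orthogonal to Yb, run at speeds c tending to 0, then give <zeta,W> <= 0. The SRCQ with
    right-hand side (eta, zeta) turns the linearized system into |eta|^2 + |zeta|^2 = <zeta,W>. *)
Lemma limit_zero : xi = ezero /\ eta = ezero /\ zeta = ezero.
Proof.
have xi0 := limit_primal_zero; split=> //.
have [LG _] := proj1 HG Xb; have [Lh _] := proj1 Hh Xb.
have D0 : D = ezero by rewrite /D xi0 (linear0 LG).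
have Leq d : eip eta (Dh Xb d) + eip zeta (DG Xb d) = 0.
  have := linearized_gradient d; rewrite xi0.
  have [L1 _] := proj1 (proj2 Hf) d Xb; have [L2 _] := proj1 (proj2 Hh) d Xb.
  have [L3 _] := proj1 (proj2 HG) d Xb.
  by rewrite (linear0 L1) (linear0 L2) (linear0 L3) !eip0r /=; lra.
have [YA0 Yle] := normal_cone_polar coneK KGb (proj2 HM).
have zW W : tangent_cone K (G Xb) W -> eip W Yb = 0 -> eip zeta W <= 0.
  move=> TW WY; have [w [Tw _]] := regK TW.
  have Hb : exists N, forall n, (N <= n)%coq_nat ->
      t n * 0 <= - eip Yb (escal (/ t n) (esub (A n) (G Xb))).
    exists 0%nat => n _; rewrite !eipE YA0.
    have := Yle _ (KA n); have := Rinv_0_lt_compat _ (t0 n); nra.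
  have main c : 0 < c -> eip zeta W + c / 2 * eip Yb w <= 0.
    move=> c0; rewrite eipC in WY.
    have := normal_sequence_ineq coneK t0 tcv KGb (proj2 HM) HA HY' KA NY Tw WY Hb c0.
    rewrite D0 eip0r => h1.
    have : c * (eip zeta W + c / 2 * eip Yb w) <= 0 by lra.
    nra.
  apply: Rnot_lt_le => z0.
  have a0 := Rabs_pos (eip Yb w).
  (* This speed makes (c/2) |<Yb,w>| smaller than <zeta,W>. *)
  have c0 : 0 < eip zeta W / (Rabs (eip Yb w) + 1) by apply: Rdiv_lt_0_compat; lra.
  have := main _ c0.
  have e : eip zeta W / (Rabs (eip Yb w) + 1) * (Rabs (eip Yb w) + 1) = eip zeta W by field; lra.
  have : - Rabs (eip Yb w) <= eip Yb w by rewrite /Rabs; case: Rcase_abs; lra.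
  move: c0 e; set rr := _ / _ => c0 e; nra.
have [Z [W [TW [WY [Ha HB]]]]] := SRCQb eta zeta.
have := zW W TW WY; have := Leq Z; rewrite Ha.
have : eip zeta zeta = eip zeta (DG Xb Z) + eip zeta W by rewrite -eipDr HB.
have := eip_ge0 eta; have := eip_ge0 zeta => ? ? ? ? ?.
by split; apply: eip_eq0; lra.
Qed.

End Sequence.

(** The auxiliary pair (A, Y') on the graph of the normal cone decouples the estimate from the way
    the system is perturbed; [rho] dominates every residual. The proof is the blow-up: normalized
    counterexamples would have a limit of norm 1, against [limit_zero]. *)
Lemma kkt_error_bound : exists mu r, 0 <= mu /\ 0 < r /\
  forall (x : E) (lam : F) (Y A Y' : H) rho,
  enorm (@esub (prodSp E (prodSp F H)) (x, (lam, Y)) (Xb, (lb, Yb))) < r ->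
  0 <= rho -> K A -> normal_cone K A Y' ->
  enorm (esub A (G x)) <= rho -> enorm (esub Y' Y) <= rho -> enorm (h x) <= rho ->
  (forall d, Rabs (lagr_grad x lam Y d) <= rho * enorm d) ->
  enorm (@esub (prodSp E (prodSp F H)) (x, (lam, Y)) (Xb, (lb, Yb))) <= mu * rho.
Proof.
apply: NNPP => Hno.
pose zb : prodSp E (prodSp F H) := (Xb, (lb, Yb)).
(* The bound is denied with mu = n + 1 and r = 1/(n+1), so the triples converge to the base point
   while rho_n is o(t_n), t_n being the distance to it. *)
have bad n : exists p : (prodSp E (prodSp F H)) * (H * H * R),
  [/\ enorm (esub p.1 zb) < / (INR n + 1) /\ 0 <= p.2.2, K p.2.1.1 /\ normal_cone K p.2.1.1 p.2.1.2,
   enorm (esub p.2.1.1 (G p.1.1)) <= p.2.2 /\ enorm (esub p.2.1.2 p.1.2.2) <= p.2.2,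
   enorm (h p.1.1) <= p.2.2 /\
   (forall d, Rabs (lagr_grad p.1.1 p.1.2.1 p.1.2.2 d) <= p.2.2 * enorm d) &
   (INR n + 1) * p.2.2 < enorm (esub p.1 zb)].
  apply: NNPP => Hn; apply: Hno; exists (INR n + 1), (/ (INR n + 1)).
  have n0 := pos_INR n; split; first lra; split; first by apply: Rinv_0_lt_compat; lra.
  move=> x lam Y A Y' rho *; apply: Rnot_lt_le => ?; apply: Hn.
  by exists ((x, (lam, Y)), ((A, Y'), rho)).
have [p Hp] := functional_choice bad.
pose z n := (p n).1; pose t n := enorm (esub (z n) zb); pose rho n := (p n).2.2.
have rho0 n : 0 <= rho n by case: (Hp n) => -[].
have tr n : (INR n + 1) * rho n < t n by case: (Hp n).
have t0 n : 0 < t n by have := tr n; have := rho0 n; have := pos_INR n; nra.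
have tcv : Un_cv t 0.
  apply: cv_sandwich0 cv_inv_succ => n; split; first exact: Rlt_le.
  by case: (Hp n) => -[h1 _] *; apply: Rlt_le.
have rt n : 0 <= / t n * rho n <= / (INR n + 1).
  have it := Rinv_0_lt_compat _ (t0 n); split; first by have := rho0 n; nra.
  have n0 := pos_INR n.
  apply: (Rmult_le_reg_l (t n * (INR n + 1))); first by have := t0 n; nra.
  have -> : t n * (INR n + 1) * (/ t n * rho n) = (INR n + 1) * rho n.
    by have := t0 n => ?; field; lra.
  have -> : t n * (INR n + 1) * / (INR n + 1) = t n by field; lra.
  by have := tr n; lra.
have small (a : nat -> R) : (forall n, 0 <= a n <= rho n) -> Un_cv (fun n => / t n * a n) 0.
  move=> Ha; apply: cv_sandwich0 cv_inv_succ => n.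
  have it := Rinv_0_lt_compat _ (t0 n).
  have := Ha n; have := rt n; nra.
pose u n := escal (/ t n) (esub (z n) zb).
have u1 n : enorm (u n) = 1.
  rewrite /u enorm_scal Rabs_pos_eq; last by have := Rinv_0_lt_compat _ (t0 n); lra.
  by rewrite -/(t n) Rinv_l //; have := t0 n; lra.
have [phi [l [Hphi Hl]]] := @ecv_bolzano _ u 1 (fun n => Req_le _ _ (u1 n)).
have l1 : enorm l = 1.
  by apply: cv_unique (ecv_enorm Hl) _; apply: cv_ext (cv_const 1) => n; rewrite u1.
have [Hl1 Hl23] := ecv_pair Hl; have [Hl2 Hl3] := ecv_pair Hl23.
have t0' n := t0 (phi n).
have tcv' := cv_extract Hphi tcv.
have := @limit_zero (fun n => t (phi n)) t0' tcv' (fun n => (z (phi n)).1)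
  (fun n => (z (phi n)).2.1) (fun n => (z (phi n)).2.2) (fun n => (p (phi n)).2.1.1)
  (fun n => (p (phi n)).2.1.2) l.1 l.2.1 l.2.2 Hl1 Hl2 Hl3.
case.
- by move=> n; case: (Hp (phi n)) => _ [].
- by move=> n; case: (Hp (phi n)) => _ [].
- apply: (cv_extract Hphi (small (fun n => enorm (h (z n).1)) _)) => n.
  by split; [apply: enorm_ge0|case: (Hp n) => _ _ _ []].
- apply: (cv_extract Hphi (small (fun n => enorm (esub (p n).2.1.1 (G (z n).1))) _)) => n.
  by split; [apply: enorm_ge0|case: (Hp n) => _ _ []].
- apply: (cv_extract Hphi (small (fun n => enorm (esub (p n).2.1.2 (z n).2.2)) _)) => n.
  by split; [apply: enorm_ge0|case: (Hp n) => _ _ []].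
- move=> d; apply: (cv_extract Hphi (u := fun n => / t n * lagr_grad (z n).1 (z n).2.1 (z n).2.2 d)).
  have : Un_cv (fun n => enorm d * / (INR n + 1)) 0.
    by rewrite -(Rmult_0_r (enorm d)); apply: cv_scal cv_inv_succ.
  move=> Hd e e0; have [N HN] := Hd e e0; exists N => n Hn; have := HN n Hn.
  have d0 := enorm_ge0 d; have n0 := pos_INR n.
  have in0 : 0 < / (INR n + 1) by apply: Rinv_0_lt_compat; lra.
  rewrite /R_dist !Rminus_0_r Rabs_pos_eq; last nra.
  apply: Rle_lt_trans; rewrite Rabs_mult Rabs_pos_eq; last first.
    by have := Rinv_0_lt_compat _ (t0 n); lra.
  have : Rabs (lagr_grad (z n).1 (z n).2.1 (z n).2.2 d) <= rho n * enorm d.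
    by case: (Hp n) => _ _ _ [].
  have it := Rinv_0_lt_compat _ (t0 n).
  move=> h1; have := Rmult_le_compat_l _ _ _ (Rlt_le _ _ it) h1.
  by have := rt n; nra.
move=> e1 [e2 e3].
have l0 : l = ezero.
  by case: (l) e1 e2 e3 => a [b c] /= -> -> ->.
by move: l1; rewrite l0 enorm0; lra.
Qed.

End KKT.

(** * Maxima and projections *)

(** Closedness of the set and continuity of [g] on it are packed into one sequential hypothesis. A
    first extraction bounds [g]; a second, from a maximizing sequence, attains the supremum. *)
Lemma max_attained (E : cspace) (S : E -> Prop) (g : E -> R) M :
  (exists x, S x) -> (forall x, S x -> enorm x <= M) ->
  (forall u l, (forall n, S (u n)) -> ecv u l -> S l /\ Un_cv (fun n => g (u n)) (g l)) ->
  exists x, S x /\ forall y, S y -> g y <= g x.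
Proof.
move=> [x0 Sx0] HM cont.
have [B HB] : exists B, forall x, S x -> g x <= B.
  apply: NNPP => Hno.
  have [u Hu] : exists u : nat -> E, forall n, S (u n) /\ INR n < g (u n).
    apply: (functional_choice (P := fun n x => S x /\ INR n < g x)) => n.
    apply: NNPP => Hn; apply: Hno; exists (INR n) => x Sx.
    by apply: Rnot_lt_le => ?; apply: Hn; exists x.
  have [phi [l [Hphi Hl]]] := ecv_bolzano (fun n => HM _ (proj1 (Hu n))).
  have [_ Hg] := cont _ _ (fun n => proj1 (Hu (phi n))) Hl.
  have [N HN] := Hg 1 Rlt_0_1.
  have [P HP] := INR_archimed 1 (Rabs (g l) + 1) Rlt_0_1.
  pose n := Nat.max N P.
  have := HN n ltac:(rewrite /n; lia); have := proj2 (Hu (phi n)).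
  have : INR P <= INR (phi n).
    apply: le_INR; have := @extraction_ge phi n Hphi; rewrite /n; lia.
  rewrite /R_dist => h1 h2 h3; have := Rle_abs (g (u (phi n)) - g l); have := Rle_abs (g l).
  by move: HP; lra.
have [||s [ub lub]] := completeness (fun r => exists x, S x /\ r = g x).
- by exists B => _ [x [Sx ->]]; apply: HB.
- by exists (g x0), x0.
have [u Hu] : exists u : nat -> E, forall n, S (u n) /\ s - / (INR n + 1) < g (u n).
  apply: (functional_choice (P := fun n x => S x /\ s - / (INR n + 1) < g x)) => n.
  apply: NNPP => Hn.
  have n0 : 0 < / (INR n + 1) by apply: Rinv_0_lt_compat; have := pos_INR n; lra.
  suff : s <= s - / (INR n + 1) by lra.
  apply: lub => r [x [Sx ->]]; apply: Rnot_lt_le => ?; apply: Hn.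
  by exists x.
have [phi [l [Hphi Hl]]] := ecv_bolzano (fun n => HM _ (proj1 (Hu n))).
have [Sl Hg] := cont _ _ (fun n => proj1 (Hu (phi n))) Hl.
exists l; split=> // y Sy; apply: (@Rle_trans _ s); first by apply: ub; exists y.
have H0 := cv_add (cv_const s) (cv_scal (-1) (cv_extract Hphi cv_inv_succ)).
rewrite Rmult_0_r Rplus_0_r in H0.
apply: (@cv_le _ _ _ _ 0 _ H0 Hg) => n _; have := proj2 (Hu (phi n)); lra.
Qed.

Section Projection.
Context (E : cspace) (K : E -> Prop) (coneK : is_cone K).
Context (K0 : K ezero) (addK : forall u v, K u -> K v -> K (eadd u v)).
Context (closedK : forall u l, (forall n, K (u n)) -> ecv u l -> K l).

Lemma proj_exists z : exists w, is_proj K z w.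
Proof.
(* Restricting to points no farther from [z] than [ezero] makes the set bounded and loses no
   minimizer. *)
pose S w := K w /\ enorm (esub z w) <= enorm (esub z ezero).
have [||u l Su Hl|w [[Kw _] Hw]] := @max_attained E S (fun w => - enorm (esub z w))
  (enorm z + enorm (esub z ezero)).
- by exists ezero; split=> //; lra.
- move=> x [_ Hx]; have -> : x = eadd z (escal (-1) (esub z x)) by evec; ring.
  have := enorm_tri z (escal (-1) (esub z x)).
  by rewrite enorm_scal Rabs_Ropp Rabs_R1; lra.
- have Hn := ecv_enorm (ecv_sub (ecv_const z) Hl).
  split; first split.
  + by apply: closedK Hl => n; case: (Su n).
  + by apply: (@cv_le _ _ _ _ 0 _ Hn (cv_const _)) => n _; case: (Su n).
  + have -> : - enorm (esub z l) = -1 * enorm (esub z l) by ring.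
    by apply: cv_ext (cv_scal (-1) Hn) => n; ring.
- exists w; split=> // w' Kw'.
  case: (Rle_lt_dec (enorm (esub z w')) (enorm (esub z ezero))) => h.
    by have := Hw w' (conj Kw' h); lra.
  by have := Hw ezero (conj K0 (Rle_refl _)); lra.
Qed.

Lemma is_proj_normal z w : is_proj K z w -> normal_cone K w (esub z w).
Proof.
move=> [Kw Hw] y Ky; apply: Rnot_lt_le => h.
set d := esub y w in h *.
have H s : 0 <= s <= 1 -> 2 * s * eip (esub z w) d <= s * s * eip d d.
  move=> s01; have := Hw (eadd (escal (1 - s) w) (escal s y)).
  have Kc : K (eadd (escal (1 - s) w) (escal s y)).
    by apply: addK; apply: coneK => //; lra.
  move=> /(_ Kc); clear Kc.
  have -> : esub z (eadd (escal (1 - s) w) (escal s y)) = esub (esub z w) (escal s d).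
    by rewrite /d; evec; ring.
  move=> le; have v0 := enorm_ge0 (esub z w).
  have := Rmult_le_compat _ _ _ _ v0 v0 le le; rewrite !enorm_sq.
  clear; move: (esub z w) d => v d; rewrite !eipBl !eipBr !eipZl !eipZr (eipC d v); lra.
have d0 := eip_ge0 d; set a := eip _ d in h H.
(* For this s one has s <d,d> = a - s a < 2 a, against [H]: moving from [w] towards [y] would
   shorten the distance. *)
have s0 : 0 < a / (eip d d + a) by apply: Rdiv_lt_0_compat; lra.
have e : a / (eip d d + a) * (eip d d + a) = a by field; lra.
have := H (a / (eip d d + a)).
move: s0 e; set s := _ / _ => s0 e; move=> h1.
have s1 : s <= 1 by nra.
have := h1 (conj (Rlt_le _ _ s0) s1); nra.
Qed.

Lemma proj_normal z : K (proj K z) /\ normal_cone K (proj K z) (esub z (proj K z)).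
Proof.
have P : is_proj K z (proj K z) by apply: epsilon_spec; apply: proj_exists.
by split; [case: P|apply: is_proj_normal].
Qed.

(** The two normality inequalities, tested at each other's base point, add up to |w - A|^2 <= 0. *)
Lemma proj_eq A Y : K A -> normal_cone K A Y -> proj K (eadd A Y) = A.
Proof.
move=> KA NY; have [Kw Nw] := proj_normal (eadd A Y).
move: (proj _ _) Kw Nw => w Kw Nw.
have h1 := NY _ Kw; have h2 := Nw _ KA.
symmetry; apply: esub_eq0; apply: eip_eq0.
move: h1 h2; rewrite !eipE => *; lra.
Qed.

End Projection.

(** The bound taken at y = ybar is the isolation of [zbar]. It is global in y, so the radius 1
    around [ybar] is arbitrary. *)
Lemma loc_upper_lipschitz_of_bound (E F : cspace) (S : E -> F -> Prop) (ybar : E) (zbar : F) mu r :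
  0 <= mu -> 0 < r -> S ybar zbar ->
  (forall y z, enorm (esub z zbar) < r -> S y z ->
    enorm (esub z zbar) <= mu * enorm (esub y ybar)) ->
  loc_upper_lipschitz S ybar zbar.
Proof.
move=> mu0 r0 Sb H; split=> //; exists mu, 1, r; do 3!(split; first lra); split.
  move=> z Hz Sz; have := H _ _ Hz Sz; rewrite esubxx enorm0 => h.
  by apply: esub_eq0; apply: norm_eq0; have := enorm_ge0 (esub z zbar); lra.
by move=> y z _ Hz Sz; apply: H.
Qed.

Lemma eip_riesz m n (phi : XSp m n -> RSp) : is_linear phi ->
  forall d, eip (riesz m n phi) d = phi d.
Proof.
move=> lin d; rewrite (linear_riesz lin) ip_co; apply: eq_bigr => i _.
rewrite Rmult_comm; congr (_ * _); case: i => [[]|[i j]] /=; congr phi; congr pair.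
Qed.

(** * Regularity from isometric flows *)

Lemma first_order_zero a b : (forall t, Rabs t <= 1 -> t * a <= t * t * b) -> a = 0.
Proof.
move=> H.
suff pos c : (forall t, 0 < t <= 1 -> t * c <= t * t * b) -> c <= 0.
  apply: Rle_antisym.
    by apply: pos => t t01; apply: H; rewrite Rabs_pos_eq; lra.
  suff : - a <= 0 by lra.
  apply: pos => t t01; have := H (- t); rewrite Rabs_Ropp Rabs_pos_eq; last lra.
  by move=> /(_ ltac:(lra)); lra.
move=> Hc; apply: Rnot_lt_le => c0.
have b0 := Rabs_pos b; have bb := Rle_abs b.
have e : c / (c + Rabs b) * (c + Rabs b) = c by field; lra.
have t0 : 0 < c / (c + Rabs b) by apply: Rdiv_lt_0_compat; lra.
have := Hc (c / (c + Rabs b)); move: t0 e; set t := _ / _ => t0 e.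
have t1 : t <= 1 by nra.
move=> /(_ (conj t0 t1)) h.
have h1 : t * c <= t * (t * Rabs b) by nra.
have h2 : c <= t * Rabs b by apply: (Rmult_le_reg_l t).
by nra.
Qed.

(* A second-order model of a one-parameter group of isometries with generator [L]. *)
Definition isometric_flow (E : cspace) (C : R -> E -> E) (L : E -> E) : Prop :=
  [/\ is_linear L, (forall t, is_linear (C t)),
   (forall u v, eip (L u) v = - eip u (L v)),
   (forall t u v, eip (C t u) v = eip u (C (- t) v)) &
   (forall u, exists B, 0 <= B /\ forall t, Rabs t <= 1 ->
     enorm (esub (C t u) (eadd u (eadd (escal t (L u)) (escal (t * t / 2) (L (L u)))))) <=
     B * (Rabs t * (t * t)))].

(** Fermat's rule at t = 0: the flow parameter runs through both signs, so the first-order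
    coefficient vanishes at a maximum. *)
Lemma flow_critical (E : cspace) (C : R -> E -> E) (L : E -> E) (c x : E) :
  isometric_flow C L -> (forall t, eip c (C t x) <= eip c x) -> eip c (L x) = 0.
Proof.
move=> [_ _ _ _ /(_ x) [b [b0 Hb]]] H; have n0 := enorm_ge0 c.
apply: (@first_order_zero _ (enorm c * b + Rabs (eip c (L (L x))))) => t t1.
have := H t; have := Hb t t1; set d := esub _ _ => hd.
have cd : - (enorm c * enorm d) <= eip c d.
  have := Rle_abs (- eip c d); rewrite Rabs_Ropp; have := cauchy_schwarz c d; lra.
have h1 : enorm c * enorm d <= enorm c * (b * (Rabs t * (t * t))) by apply: Rmult_le_compat_l.
have tt := Rle_0_sqr t; rewrite /Rsqr in tt.
have h2 : enorm c * (b * (Rabs t * (t * t))) <= enorm c * (b * (t * t)).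
  by do 2!(apply: Rmult_le_compat_l => //); nra.
have : - (enorm c * (b * (t * t))) <= eip c d by lra.
rewrite /d eipBr !eipDr !eipZr.
have := Rle_abs (- eip c (L (L x))); rewrite Rabs_Ropp.
set z := eip c (L (L x)) => hz {}cd fl.
have h3 : t * t * (- z) <= t * t * Rabs z by apply: Rmult_le_compat_l.
have h4 : 0 <= t * t * Rabs z by apply: Rmult_le_pos => //; apply: Rabs_pos.
lra.
Qed.

(** The arc is C_t (A + t (D - L A)), whose velocity at 0 is D; its second-order term is [w]. For
    the inequality, a point u = A + t D' of [K] is moved back: <C_t Y, u> = <Y, C_(-t) u> <= 0.
    Expanding C_t Y to second order leaves t <Y,D'> + t^2 <LY,D'> + (t^2/2) <LLY,A> <= O(t^3), and
    skewness of L gives <Y,w> = -2 <LY,D> - <LLY,A>. *)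
Lemma flow_parabolically_regular (E : cspace) (K : E -> Prop) (A Y : E) :
  is_cone K -> K A -> normal_cone K A Y ->
  (forall D, tangent_cone K A D -> exists C L,
    isometric_flow C L /\ (forall t u, K u -> K (C t u)) /\
    exists T, 0 < T /\ forall t, 0 < t < T -> K (eadd A (escal t (esub D (L A))))) ->
  parabolically_regular K A Y.
Proof.
move=> coneK KA NY HD D TD.
have [C [L [flowC [KC [T [T0 HT]]]]]] := HD D TD.
have [linL linC skewL adjC expC] := flowC.
have [YA Yle] := normal_cone_polar coneK KA NY.
pose D1 := esub D (L A).
pose w := eadd (escal 2 (L D1)) (L (L A)).
have LD1 : L D1 = esub (L D) (L (L A)).
  by rewrite /D1 /esub (proj1 linL) (proj2 linL).
exists w; split.
  move=> eps eps0.
  have [B1 [B10 H1]] := expC A; have [B2 [B20 H2]] := expC D1.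
  have n0 := enorm_ge0 (L (L D1)).
  (* [B] collects the t^3 remainders of C_t A and t C_t D1 and the neglected t^3/2 term in L L D1;
     adding 1 makes it positive. *)
  set B := B1 + B2 + enorm (L (L D1)) + 1.
  have B0 : 0 < B by rewrite /B; lra.
  have e0 : 0 < eps / B by apply: Rdiv_lt_0_compat.
  exists (Rmin (Rmin T 1) (eps / B)); split; first by do 2!(apply: Rmin_pos => //); lra.
  move=> t [t0]; move=> /Rmin_Rgt_l[/Rmin_Rgt_l[tT t1] tB].
  exists (C t (eadd A (escal t D1))); split; first by apply/KC/HT; lra.
  have := H1 t; have := H2 t; rewrite Rabs_pos_eq; last lra.
  move=> /(_ ltac:(lra)) h2 /(_ ltac:(lra)) h1.
  rewrite (proj1 (linC t)) (proj2 (linC t)).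
  set r1 := esub (C t A) _ in h1; set r2 := esub (C t D1) _ in h2.
  have -> : esub (eadd A (eadd (escal t D) (escal (t * t / 2) w))) (eadd (C t A) (escal t (C t D1)))
    = eadd (escal (-1) r1) (eadd (escal (- t) r2) (escal (- (t * (t * t)) / 2) (L (L D1)))).
    by rewrite /r1 /r2 /w /D1; evec; field.
  have := enorm_tri (escal (-1) r1)
    (eadd (escal (- t) r2) (escal (- (t * (t * t)) / 2) (L (L D1)))).
  have := enorm_tri (escal (- t) r2) (escal (- (t * (t * t)) / 2) (L (L D1))).
  rewrite !enorm_scal !Rabs_Ropp Rabs_R1 (Rabs_pos_eq t); last lra.
  have -> : - (t * (t * t)) / 2 = - (t * (t * t) / 2) by field.
  have t3 : 0 < t * (t * t) by do !apply: Rmult_lt_0_compat.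
  rewrite Rabs_Ropp Rabs_pos_eq; last lra.
  have k : t * B < eps.
    have := Rmult_lt_compat_r _ _ _ B0 tB; have -> : eps / B * B = eps by field; lra.
    by [].
  have h3 : t * enorm r2 <= B2 * (t * (t * t)).
    have : t * enorm r2 <= t * (B2 * (t * (t * t))) by apply: Rmult_le_compat_l; lra.
    have : 0 <= B2 * (t * (t * t)) by nra.
    nra.
  have h4 : t * B * (t * t) < eps * (t * t) by apply: Rmult_lt_compat_r => //; nra.
  have h5 : 0 <= t * (t * t) * enorm (L (L D1)) by apply: Rmult_le_pos; lra.
  by move: h4; rewrite /B; lra.
move=> eps eps0.
have [B [B0 HB]] := expC Y.
pose r t := esub (C t Y) (eadd Y (eadd (escal t (L Y)) (escal (t * t / 2) (L (L Y))))).
have CY t : C t Y = eadd (r t) (eadd Y (eadd (escal t (L Y)) (escal (t * t / 2) (L (L Y))))).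
  by rewrite /r; evec; ring.
have {}HB t : Rabs t <= 1 -> enorm (r t) <= B * (Rabs t * (t * t)) by exact: HB.
clearbody r.
have Cle t u : K u -> eip (C t Y) u <= 0.
  by move=> Ku; rewrite adjC; apply: Yle; apply: KC.
have rle t u : Rabs t <= 1 -> Rabs (eip (r t) u) <= B * (Rabs t * (t * t)) * enorm u.
  move=> t1; apply: Rle_trans (cauchy_schwarz _ _) _.
  by apply: Rmult_le_compat_r; [apply: enorm_ge0|apply: HB].
(* The orbit of A stays in [K], where <Y, .> is nonpositive and vanishes at A, so A maximizes it
   along the orbit. This removes the first-order term. *)
have LYA : eip (L Y) A = 0.
  have -> : 0 = - 0 by ring.
  rewrite skewL; congr (- _); apply: (flow_critical flowC) => t.
  by rewrite YA; apply/Yle/KC.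
have A0 := enorm_ge0 A; have D0 := enorm_ge0 D; have LY0 := enorm_ge0 (L Y).
have LLY0 := enorm_ge0 (L (L Y)).
(* [M] dominates the third-order errors, and [N] controls the replacement of D' by D in <LY,D'>;
   each accounts for half of [eps]. *)
set M := 2 * B * (enorm A + (enorm D + 1)) + enorm (L (L Y)) * (enorm D + 1) + 1.
have M0 : 0 < M.
  have h1 : 0 <= B * (enorm A + (enorm D + 1)) by apply: Rmult_le_pos; lra.
  have h2 : 0 <= enorm (L (L Y)) * (enorm D + 1) by apply: Rmult_le_pos; lra.
  by rewrite /M; lra.
set N := 4 * (enorm (L Y) + 1).
have N0 : 0 < N by rewrite /N; lra.
exists (Rmin (Rmin 1 (eps / (2 * M))) (eps / N)); split.
  by do !apply: Rmin_pos; try apply: Rdiv_lt_0_compat; lra.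
move=> t D' [t0]; move=> /Rmin_Rgt_l[/Rmin_Rgt_l[t1 tM] tN].
move=> /Rmin_Rgt_l[/Rmin_Rgt_l[d1 dM] dN] KD'.
have D'D : enorm D' <= enorm D + 1.
  have -> : D' = eadd (esub D' D) D by evec; ring.
  by have := enorm_tri (esub D' D) D; lra.
have at1 : Rabs t <= 1 by rewrite Rabs_pos_eq; lra.
have atE : Rabs t = t by rewrite Rabs_pos_eq; lra.
have := Cle t _ KD'; rewrite eipDr eipZr.
have hA := rle t A at1; have hD := rle t D' at1; rewrite atE in hA hD.
rewrite {1 2}CY !eipDl !eipZl YA LYA.
have hLYD : - (enorm (L Y) * enorm (esub D' D)) <= eip (L Y) (esub D' D).
  have := Rle_abs (- eip (L Y) (esub D' D)); rewrite Rabs_Ropp.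
  by have := cauchy_schwarz (L Y) (esub D' D); lra.
have hLLYD : - (enorm (L (L Y)) * enorm D') <= eip (L (L Y)) D'.
  have := Rle_abs (- eip (L (L Y)) D'); rewrite Rabs_Ropp.
  by have := cauchy_schwarz (L (L Y)) D'; lra.
have {}hA : - (B * (t * (t * t)) * enorm A) <= eip (r t) A.
  by have := Rle_abs (- eip (r t) A); rewrite Rabs_Ropp; lra.
have {}hD : - (B * (t * (t * t)) * enorm D') <= eip (r t) D'.
  by have := Rle_abs (- eip (r t) D'); rewrite Rabs_Ropp; lra.
have Yw : eip Y w = - 2 * eip (L Y) D - eip (L (L Y)) A.
  rewrite /w LD1 eipDr eipZr eipBr.
  have e1 := skewL Y D; have e2 := skewL Y (L A); have e3 := skewL (L Y) A.
  lra.
move: hLYD; rewrite eipBr Yw.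
have tM' : t * M < eps / 2.
  have := Rmult_lt_compat_r _ _ _ M0 tM; have -> : eps / (2 * M) * M = eps / 2 by field; lra.
  by [].
have dN' : 2 * (enorm (L Y) * enorm (esub D' D)) <= eps / 2.
  have := Rmult_lt_compat_r _ _ _ N0 dN; have -> : eps / N * N = eps by field; lra.
  rewrite /N; have := enorm_ge0 (esub D' D); nra.
move: (enorm (esub D' D)) dN' => dd dN'.
move: (eip (L Y) D) (eip (L Y) D') (eip (L (L Y)) A) (eip (L (L Y)) D') (eip Y D')
  (eip (r t) A) (eip (r t) D') hA hD hLLYD => lyd lyd' llya llyd' yd' ra rd hA hD h1 h2 h3.
have D'0 := enorm_ge0 D'.
apply: (Rmult_le_reg_l t) => //.
have tt : 0 <= t * t by apply: Rmult_le_pos; lra.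
have ttt : 0 <= t * (t * t) by apply: Rmult_le_pos; lra.
have BP : 0 <= B * (t * (t * t)) by apply: Rmult_le_pos.
have k1 : B * (t * (t * t)) * enorm D' <= B * (t * (t * t)) * (enorm D + 1).
  exact: Rmult_le_compat_l.
have k2 : t * (B * (t * (t * t)) * enorm D') <= B * (t * (t * t)) * enorm D'.
  have : 0 <= B * (t * (t * t)) * enorm D' by apply: Rmult_le_pos.
  by nra.
have k3 : t * (t * t) * (enorm (L (L Y)) * enorm D') <=
          t * (t * t) * (enorm (L (L Y)) * (enorm D + 1)).
  by apply: Rmult_le_compat_l => //; apply: Rmult_le_compat_l.
have k4 : t * t * (t * M) <= t * t * (eps / 2) by apply: Rmult_le_compat_l; lra.
have k5 : t * t * (2 * (enorm (L Y) * dd)) <= t * t * (eps / 2) by apply: Rmult_le_compat_l; lra.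
have k6 : t * t * (- (enorm (L Y) * dd)) <= t * t * (lyd' - lyd) by apply: Rmult_le_compat_l; lra.
have k7 : t * (t * t) * (- (enorm (L (L Y)) * enorm D')) <= t * (t * t) * llyd'.
  by apply: Rmult_le_compat_l; lra.
have k8 : t * (- (B * (t * (t * t)) * enorm D')) <= t * rd by apply: Rmult_le_compat_l; lra.
by move: k4; rewrite /M; lra.
Qed.

(** * Orthogonal matrices and the Cayley transform *)

Section MatrixInnerProduct.
Implicit Types m n q : nat.

Definition mip m n (A B : 'M[R]_(m, n)) : R :=
  \big[Rplus/0]_i \big[Rplus/0]_j (A i j * B i j).

Lemma mip_tr m n (A B : 'M[R]_(m, n)) : mip A B = (\tr (A^T *m B))%R.
Proof.
rewrite /mip /mxtrace exchange_big; apply: eq_bigr => j _.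
by rewrite mxE; apply: eq_bigr => i _; rewrite mxE.
Qed.

Lemma mipC m n (A B : 'M[R]_(m, n)) : mip A B = mip B A.
Proof. by apply: eq_bigr => i _; apply: eq_bigr => j _; rewrite Rmult_comm. Qed.

Lemma mip_mull m n q (P : 'M[R]_(m, q)) (A : 'M[R]_(q, n)) B : mip (P *m A)%R B = mip A (P^T *m B)%R.
Proof. by rewrite !mip_tr trmx_mul mulmxA. Qed.

Lemma mip_mulr m n q (Q : 'M[R]_(q, n)) (A : 'M[R]_(m, q)) B : mip (A *m Q)%R B = mip A (B *m Q^T)%R.
Proof. by rewrite !mip_tr trmx_mul -mulmxA mxtrace_mulC mulmxA. Qed.

Lemma mipDr m n (A B C : 'M[R]_(m, n)) : mip A (B + C)%R = mip A B + mip A C.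
Proof. by rewrite !mip_tr mulmxDr mxtraceD. Qed.

Lemma mipNr m n (A B : 'M[R]_(m, n)) : mip A (- B)%R = - mip A B.
Proof. by rewrite !mip_tr mulmxN raddfN. Qed.

Lemma mipNl m n (A B : 'M[R]_(m, n)) : mip (- A)%R B = - mip A B.
Proof. by rewrite mipC mipNr mipC. Qed.

Lemma mipDl m n (A B C : 'M[R]_(m, n)) : mip (A + B)%R C = mip A C + mip B C.
Proof. by rewrite !(mipC _ C) mipDr. Qed.

Lemma mip_entry m n (A : 'M[R]_(m, n)) i j : A i j * A i j <= mip A A.
Proof.
apply: (@Rle_trans _ (\big[Rplus/0]_j (A i j * A i j))).
  by apply: (@rsum_term_le _ (fun j => A i j * A i j)) => j'; apply: Rle_0_sqr.
apply: (@rsum_term_le _ (fun i => \big[Rplus/0]_j (A i j * A i j))) => i'.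
by apply: rsum_ge0 => j' _; apply: Rle_0_sqr.
Qed.

Lemma mip_eq0 m n (A : 'M[R]_(m, n)) : mip A A = 0 -> A = 0%R.
Proof.
move=> H; apply/matrixP => i j; rewrite mxE; have := mip_entry A i j; rewrite H => h.
by apply: Rsqr_0_uniq; apply: Rle_antisym (Rle_0_sqr _); exact: h.
Qed.

Lemma mulmxEr m n q (A : 'M[R]_(m, q)) (B : 'M[R]_(q, n)) i j :
  (A *m B)%R i j = \big[Rplus/0]_k (A i k * B k j).
Proof. by rewrite mxE. Qed.

Lemma addmxEr m n (A B : 'M[R]_(m, n)) i j : (A + B)%R i j = A i j + B i j.
Proof. by rewrite mxE. Qed.

Lemma oppmxEr m n (A : 'M[R]_(m, n)) i j : (- A)%R i j = - A i j.
Proof. by rewrite mxE. Qed.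

Lemma scalemxEr m n (a : R) (A : 'M[R]_(m, n)) i j : (a *: A)%R i j = a * A i j.
Proof. by rewrite mxE. Qed.

Lemma zeromxEr m n i j : (0 : 'M[R]_(m, n))%R i j = 0.
Proof. by rewrite mxE. Qed.

Lemma idmxEr n (i j : 'I_n) : (1%:M : 'M[R]_n)%R i j = if i == j then 1 else 0.
Proof. by rewrite mxE; case: eqP. Qed.

Definition mxEr := (addmxEr, oppmxEr, scalemxEr, zeromxEr).

Definition orth q (U : 'M[R]_q) : Prop := (U^T *m U = 1%:M)%R.

Lemma orthV q (U : 'M[R]_q) : orth U -> (U *m U^T = 1%:M)%R.
Proof. exact: mulmx1C. Qed.

Lemma orth1 q : orth (1%:M : 'M[R]_q)%R.
Proof. by rewrite /orth trmx1 mulmx1. Qed.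

Lemma orth_tr q (U : 'M[R]_q) : orth U -> orth (U^T)%R.
Proof. by move=> H; rewrite /orth trmxK; apply: orthV. Qed.

Lemma orthM q (U V : 'M[R]_q) : orth U -> orth V -> orth (U *m V)%R.
Proof.
by move=> HU HV; rewrite /orth trmx_mul -mulmxA (mulmxA (U^T)%R) HU mul1mx.
Qed.

Lemma orth_row q (U : 'M[R]_q) i : orth U -> \big[Rplus/0]_j (U i j * U i j) = 1.
Proof.
move=> /orthV/matrixP/(_ i i); rewrite mulmxEr idmxEr eqxx => <-.
by apply: eq_bigr => j _; rewrite mxE.
Qed.

Lemma orth_col q (U : 'M[R]_q) j : orth U -> \big[Rplus/0]_i (U i j * U i j) = 1.
Proof.
move=> /orth_tr/(@orth_row _ _ j) <-; by apply: eq_bigr => i _; rewrite mxE.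
Qed.

Lemma orth_entry q (U : 'M[R]_q) i j : orth U -> Rabs (U i j) <= 1.
Proof.
move=> /(@orth_row _ _ i) H.
have := @rsum_term_le _ (fun j => U i j * U i j) j (fun j => Rle_0_sqr _); rewrite H => h.
by rewrite /Rabs; case: Rcase_abs; nra.
Qed.

End MatrixInnerProduct.

(* Distinct canonical-structure paths make convertible entries syntactically different, so the
   entries are generalized before the arithmetic solver is called. *)
Ltac entrywise := apply/matrixP => ? ?; rewrite !mxEr;
  repeat match goal with |- context [@fun_of_matrix ?T ?m ?n ?A ?i ?j] =>
    move: (@fun_of_matrix T m n A i j) => ? end;
  match goal with |- @eq _ ?a ?b => change (@eq R a b) end.

Section Cayley.
Context (q : nat).
Implicit Types A C : 'M[R]_q.

Definition skew_sym A : Prop := (A^T = - A)%R.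

(** A rational substitute for the matrix exponential: it maps skew-symmetric matrices to orthogonal
    ones and has an exact algebraic expansion. *)
Definition cayley C : 'M[R]_q := (invmx (1%:M - C) *m (1%:M + C))%R.

(** A row vector fixed by C satisfies |v|^2 = <vC,v> = -<v,vC> = -|v|^2. *)
Lemma skew_unit C : skew_sym C -> (1%:M - C)%R \in unitmx.
Proof.
move=> sC; rewrite -row_free_unit -kermx_eq0; apply/rowV0P => v /sub_kermxP.
rewrite mulmxBr mulmx1 => /eqP; rewrite subr_eq0 => /eqP vC.
apply: mip_eq0; have : mip v v = - mip v v.
  by rewrite {1}vC mip_mulr sC mulmxN mipNr -vC.
by move=> ?; lra.
Qed.

Lemma skewZ (a : R) C : skew_sym C -> skew_sym (a *: C)%R.
Proof. by rewrite /skew_sym linearZ /= => ->; rewrite scalerN. Qed.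

Lemma skewN C : skew_sym C -> skew_sym (- C)%R.
Proof. by rewrite /skew_sym linearN /= => ->. Qed.

Lemma comm_cayley C : ((1%:M - C) *m (1%:M + C) = (1%:M + C) *m (1%:M - C))%R.
Proof.
rewrite !mulmxDl !mulmxDr !mulmxN !mulNmx !mul1mx !mulmx1.
by entrywise; lra.
Qed.

Lemma cayley_mul C : skew_sym C -> ((1%:M - C) *m cayley C = 1%:M + C)%R.
Proof. by move=> sC; rewrite mulmxA mulmxV ?mul1mx //; apply: skew_unit. Qed.

Lemma cayleyN_inv C : skew_sym C -> (cayley (- C) *m cayley C = 1%:M)%R.
Proof.
move=> sC; have uN := skew_unit (skewN sC); rewrite opprK in uN.
rewrite /cayley opprK -mulmxA cayley_mul // mulVmx //.
Qed.

Lemma cayley_tr C : skew_sym C -> ((cayley C)^T = cayley (- C))%R.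
Proof.
move=> sC; have u := skew_unit sC; have uN := skew_unit (skewN sC); rewrite opprK in uN.
have e1 : ((1%:M - C)^T = 1%:M + C)%R by rewrite linearB /= trmx1 sC opprK.
have e2 : ((1%:M + C)^T = 1%:M - C)%R by rewrite linearD /= trmx1 sC.
rewrite /cayley opprK trmx_mul trmx_inv e1 e2.
apply: (can_inj (mulKmx uN)); apply: (can_inj (mulmxK uN)).
by rewrite -!mulmxA mulVmx // mulmx1 mulKVmx // comm_cayley.
Qed.

Lemma cayley_orth C : skew_sym C -> orth (cayley C).
Proof. by move=> sC; rewrite /orth cayley_tr // cayleyN_inv. Qed.

(** An exact identity rather than an estimate: the cubic remainder has the factor cayley C + 1,
    bounded by orthogonality. It is verified after multiplication by 1 - C, using (1 - C)(cayley C +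
    1) = 2. *)
Lemma cayley_expand C : skew_sym C ->
  (cayley C = 1%:M + (C + C) + (C *m C + C *m C) + (cayley C + 1%:M) *m (C *m (C *m C)))%R.
Proof.
move=> sC; have u := skew_unit sC.
have e : ((1%:M - C) *m (cayley C + 1%:M) = 1%:M + 1%:M)%R.
  by rewrite mulmxDr cayley_mul // mulmx1 addrACA subrr addr0.
apply: (can_inj (mulKmx u)); rewrite cayley_mul //.
transitivity ((1%:M - C) *m (1%:M + (C + C) + (C *m C + C *m C)) +
  ((1%:M - C) *m (cayley C + 1%:M)) *m (C *m (C *m C)))%R; last by rewrite [RHS]mulmxDr !mulmxA.
rewrite e !mulmxDl !mulmxDr !mul1mx !mulmx1 !mulNmx !mulmxA.
by entrywise; lra.
Qed.

End Cayley.

(** An infinitesimal intertwining relation passes to the orthogonal matrices, so that generators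
    stabilizing a diagonal form yield rotations stabilizing it. *)
Lemma cayley_comm m n (A : 'M[R]_m) (B : 'M[R]_n) (D : 'M[R]_(m, n)) :
  skew_sym A -> skew_sym B -> (A *m D = D *m B)%R -> (cayley A *m D = D *m cayley B)%R.
Proof.
move=> sA sB e; have uA := skew_unit sA; have uB := skew_unit sB.
apply: (can_inj (mulKmx uA)); rewrite mulmxA cayley_mul //.
rewrite mulmxA mulmxBl mul1mx e -{2}(mulmx1 D) -mulmxBr -mulmxA cayley_mul //.
by rewrite mulmxDl mulmxDr mul1mx mulmx1 e.
Qed.

(** * Families of matrices bounded for |t| <= 1, the coefficients of cubic remainders *)

Section BoundedFamilies.
Implicit Types m n : nat.

Definition mbd m n (M : R -> 'M[R]_(m, n)) : Prop :=
  exists B, 0 <= B /\ forall t, Rabs t <= 1 -> forall i j, Rabs (M t i j) <= B.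

Lemma mbd_const m n (A : 'M[R]_(m, n)) : mbd (fun _ => A).
Proof.
exists (sqrt (mip A A)); split=> [|t _ i j]; first exact: sqrt_pos.
by rewrite -sqrt_Rsqr_abs; apply: sqrt_le_1_alt; apply: mip_entry.
Qed.

Lemma mbd_add m n (M N : R -> 'M[R]_(m, n)) : mbd M -> mbd N -> mbd (fun t => M t + N t)%R.
Proof.
move=> [a [a0 Ha]] [b [b0 Hb]]; exists (a + b); split=> [|t t1 i j]; first lra.
rewrite mxEr; have := Ha t t1 i j; have := Hb t t1 i j.
by have := Rabs_triang (M t i j) (N t i j); lra.
Qed.

Lemma mbd_scal m n (c : R -> R) (M : R -> 'M[R]_(m, n)) :
  (forall t, Rabs t <= 1 -> Rabs (c t) <= 1) -> mbd M -> mbd (fun t => c t *: M t)%R.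
Proof.
move=> Hc [a [a0 Ha]]; exists a; split=> // t t1 i j; rewrite mxEr Rabs_mult.
have := Ha t t1 i j; have := Hc t t1; have := Rabs_pos (c t); have := Rabs_pos (M t i j); nra.
Qed.

Lemma mbd_mul m n q (M : R -> 'M[R]_(m, q)) (N : R -> 'M[R]_(q, n)) :
  mbd M -> mbd N -> mbd (fun t => M t *m N t)%R.
Proof.
move=> [a [a0 Ha]] [b [b0 Hb]]; exists (\big[Rplus/0]_(k < q) (a * b)).
split=> [|t t1 i j]; first by apply: rsum_ge0 => k _; nra.
rewrite mulmxEr; apply: (@Rle_trans _ (\big[Rplus/0]_k (Rabs (M t i k * N t k j)))).
  elim/big_rec2: _ => [|k x y _ IH]; first by rewrite Rabs_R0; lra.
  by apply: Rle_trans (Rabs_triang _ _) _; lra.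
apply: rsum_le => k _; rewrite Rabs_mult.
by apply: Rmult_le_compat; try exact: Rabs_pos; [apply: Ha|apply: Hb].
Qed.

Lemma mbd_tr m n (M : R -> 'M[R]_(m, n)) : mbd M -> mbd (fun t => (M t)^T)%R.
Proof. by move=> [a [a0 Ha]]; exists a; split=> // t t1 i j; rewrite mxE; apply: Ha. Qed.

Lemma mbd_orth q (P : R -> 'M[R]_q) : (forall t, orth (P t)) -> mbd P.
Proof. by move=> H; exists 1; split=> [|t _ i j]; [lra|apply: orth_entry]. Qed.

End BoundedFamilies.

(** * The flow of conjugations *)

Section MatrixConversion.
Implicit Types m n : nat.

Definition mx_of m n (A : Mat m n) : 'M[R]_(m, n) := (\matrix_(i, j) A i j)%R.
Definition of_mx m n (A : 'M[R]_(m, n)) : Mat m n := fun i j => A i j.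

Lemma of_mxK m n (A : 'M[R]_(m, n)) : mx_of (of_mx A) = A.
Proof. by apply/matrixP => i j; rewrite mxE. Qed.

Lemma mx_ofK m n (A : Mat m n) : of_mx (mx_of A) = A.
Proof. by do 2!apply: functional_extensionality => ?; rewrite /of_mx mxE. Qed.

Definition xmx m n (u : XSp m n) : 'M[R]_(m, n) := mx_of u.2.
Definition xpt m n (a : R) (A : 'M[R]_(m, n)) : XSp m n := (a, of_mx A).

Lemma xmx_xpt m n a (A : 'M[R]_(m, n)) : xmx (xpt a A) = A.
Proof. exact: of_mxK. Qed.

Lemma x_ext m n (u v : XSp m n) : u.1 = v.1 -> xmx u = xmx v -> u = v.
Proof.
case: u v => [a A] [b B] /= -> e; congr pair.
by rewrite -(mx_ofK A) -(mx_ofK B); congr of_mx.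
Qed.

Lemma xmxD m n (u v : XSp m n) : xmx (eadd u v) = (xmx u + xmx v)%R.
Proof. by apply/matrixP => i j; rewrite mxEr !mxE. Qed.

Lemma xmxZ m n a (u : XSp m n) : xmx (escal a u) = (a *: xmx u)%R.
Proof. by apply/matrixP => i j; rewrite mxEr !mxE. Qed.

Lemma xip m n (u v : XSp m n) : eip u v = u.1 * v.1 + mip (xmx u) (xmx v).
Proof.
congr (_ + _); apply: eq_bigr => i _; apply: eq_bigr => j _; by rewrite !mxE.
Qed.

End MatrixConversion.

(** The half angle gives 1 + t A + (t^2/2) A^2 + O(t^3), in agreement with exp(t A) through second
    order. *)
Definition rotation q (A : 'M[R]_q) (t : R) : 'M[R]_q := let h := t / 2 in cayley (h *: A)%R.

Section Rotation.
Context (q : nat) (A : 'M[R]_q) (sA : skew_sym A).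

Lemma rotation_orth t : orth (rotation A t).
Proof. by apply: cayley_orth; apply: skewZ. Qed.

Lemma rotationN t : rotation A (- t) = ((rotation A t)^T)%R.
Proof.
rewrite /rotation cayley_tr; last exact: skewZ.
by congr cayley; entrywise; lra.
Qed.

Lemma rotation_expand t h : h = t / 2 ->
  (rotation A t = (1%:M + (h + h) *: A + (h * h + h * h) *: (A *m A)) +
    (h * h * h) *: ((rotation A t + 1%:M) *m (A *m (A *m A))))%R.
Proof.
move=> eh; rewrite {1}/rotation -eh cayley_expand; last exact: skewZ.
rewrite -!(scalemxAl, scalemxAr) /rotation -eh.
by entrywise; rewrite -?(RplusE, RmultE); ring.
Qed.

End Rotation.

Section Conjugation.
Context (m n : nat) (A : 'M[R]_m) (B : 'M[R]_n) (sA : skew_sym A) (sB : skew_sym B).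

Definition conj_mx t (X : 'M[R]_(m, n)) : 'M[R]_(m, n) :=
  (rotation A t *m X *m (rotation B t)^T)%R.

Definition conj_gen (X : 'M[R]_(m, n)) : 'M[R]_(m, n) := (A *m X - X *m B)%R.

Lemma conj_expand_poly (X : 'M[R]_(m, n)) (h : R) :
  ((1%:M + (h + h) *: A + (h * h + h * h) *: (A *m A)) *m X *m
    (1%:M + (h + h) *: (- B) + (h * h + h * h) *: (B *m B)) =
  X + ((h + h) *: conj_gen X + (h * h + h * h) *: conj_gen (conj_gen X)) +
   (h * h * h) *: (((1 + 1) *: (((1 + 1) *: (A *m X *m (B *m B)))
     - ((1 + 1) *: (A *m A *m X *m B)))) +
     h *: ((1 + 1) *: ((1 + 1) *: (A *m A *m X *m (B *m B))))))%R.
Proof.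
rewrite /conj_gen; do !rewrite !(mulmxDl, mulmxDr, mulmxN, mulNmx, mul1mx, mulmx1).
rewrite -!(scalemxAl, scalemxAr) !(mulmxN, mulNmx) !mulmxA.
entrywise; rewrite -!(RplusE, RmultE).
have -> : (1%R : R) = 1 by [].
ring.
Qed.

(** Both rotations are replaced by their quadratic parts, and [conj_expand_poly] multiplies those
    out exactly. With h = t/2 as a separate variable everything stays polynomial. *)
Lemma conj_expand (X : 'M[R]_(m, n)) : exists Rem : R -> 'M[R]_(m, n), mbd Rem /\
  forall t h, h = t / 2 -> conj_mx t X =
   (X + ((h + h) *: conj_gen X + (h * h + h * h) *: conj_gen (conj_gen X)) +
    (h * h * h) *: Rem t)%R.
Proof.
pose P t := rotation A t; pose Q t := rotation B t.
pose RP t := ((P t + 1%:M) *m (A *m (A *m A)))%R.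
pose RQ t := ((Q t + 1%:M) *m (B *m (B *m B)))%R.
pose P2 h := (1%:M + (h + h) *: A + (h * h + h * h) *: (A *m A))%R.
pose Q2 h := (1%:M + (h + h) *: (- B) + (h * h + h * h) *: (B *m B))%R.
pose E h := (((1 + 1) *: (((1 + 1) *: (A *m X *m (B *m B)))
     - ((1 + 1) *: (A *m A *m X *m B)))) +
     h *: ((1 + 1) *: ((1 + 1) *: (A *m A *m X *m (B *m B)))))%R.
have eP t h : h = t / 2 -> P t = (P2 h + (h * h * h) *: RP t)%R by exact: rotation_expand.
have eQ t h : h = t / 2 -> (Q t)^T%R = (Q2 h + (h * h * h) *: (RQ t)^T)%R.
  move=> eh; rewrite {1}/Q (rotation_expand sB eh) linearD linearZ /=; congr (_ + _)%R.
  by rewrite /Q2 !linearD !linearZ /= trmx1 trmx_mul sB mulNmx mulmxN opprK.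
have bP : mbd P by apply: mbd_orth => t; apply: rotation_orth.
have bQ : mbd Q by apply: mbd_orth => t; apply: rotation_orth.
have bRP : mbd RP by apply: mbd_mul; [apply: mbd_add => //|]; apply: mbd_const.
have bRQ : mbd RQ by apply: mbd_mul; [apply: mbd_add => //|]; apply: mbd_const.
have half t : Rabs t <= 1 -> - (/ 2) <= t / 2 <= / 2.
  by rewrite /Rabs; case: Rcase_abs; lra.
have bE : mbd (fun t => E (t / 2)).
  apply: mbd_add; first exact: mbd_const.
  apply: mbd_scal (mbd_const _) => t /half h; rewrite /Rabs; case: Rcase_abs; lra.
have bP2 : mbd (fun t => P2 (t / 2)).
  apply: mbd_add; first apply: mbd_add; first exact: mbd_const.
  - apply: mbd_scal (mbd_const _) => t /half h; rewrite -RplusE /Rabs; case: Rcase_abs; lra.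
  - apply: mbd_scal (mbd_const _) => t /half h; rewrite -RplusE -RmultE.
    rewrite /Rabs; case: Rcase_abs; nra.
pose hf t := t / 2.
(* Replacing one factor at a time: P X Q^T - P2 X Q2 splits into the error of P next to the exact
   Q^T and the error of Q^T next to P2. The last summand is the cubic part of P2 X Q2. *)
exists (fun t => RP t *m X *m (Q t)^T + P2 (hf t) *m X *m (RQ t)^T + E (hf t))%R.
split.
  apply: mbd_add => //; apply: mbd_add.
    by apply: mbd_mul; [apply: mbd_mul => //; apply: mbd_const|apply: mbd_tr].
  by apply: mbd_mul; [apply: mbd_mul => //; apply: mbd_const|apply: mbd_tr].
have key h : (P2 h *m X *m Q2 h = X + ((h + h) *: conj_gen X +
    (h * h + h * h) *: conj_gen (conj_gen X)) + (h * h * h) *: E h)%R.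
  exact: conj_expand_poly.
move=> t h eh; rewrite /conj_mx -/(P t) -/(Q t) /hf -eh.
clearbody P2 Q2 E RP RQ P Q; rewrite {1}(eP t _ eh) 2!mulmxDl {1}(eQ t _ eh) mulmxDr key.
rewrite -!(scalemxAl, scalemxAr); move: (h + h)%R (h * h + h * h)%R (h * h * h)%R => a b c.
by entrywise; rewrite -?(RplusE, RmultE); ring.
Qed.

Lemma conj_mx_adj t (X Y : 'M[R]_(m, n)) : mip (conj_mx t X) Y = mip X (conj_mx (- t) Y).
Proof. by rewrite mip_mulr mip_mull /conj_mx !rotationN // trmxK mulmxA. Qed.

Lemma conj_gen_skew (X Y : 'M[R]_(m, n)) : mip (conj_gen X) Y = - mip X (conj_gen Y).
Proof.
rewrite /conj_gen mipDl mipNl (mip_mull A X Y) (mip_mulr B X Y) sA sB mulNmx mulmxN !mipNr.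
rewrite mipDr mipNr; move: (mip X (A *m Y)%R) (mip X (Y *m B)%R) => a b; ring.
Qed.

Lemma conj_mx_norm_bound (M : R -> 'M[R]_(m, n)) : mbd M ->
  exists C, 0 <= C /\ forall t, Rabs t <= 1 -> enorm (xpt 0 (M t)) <= C.
Proof.
move=> [b [b0 Hb]]; exists (\big[Rplus/0]_(i : idx (coords_X m n)) b).
split=> [|t t1]; first by apply: rsum_ge0.
apply: Rle_trans (norm_le_co _) _; apply: rsum_le => -[[]|[i j]] _ /=.
  by rewrite Rabs_R0.
exact: Hb.
Qed.

Definition flow t (u : XSp m n) : XSp m n := xpt u.1 (conj_mx t (xmx u)).
Definition flow_gen (u : XSp m n) : XSp m n := xpt 0 (conj_gen (xmx u)).

Lemma flow_isometric : isometric_flow flow flow_gen.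
Proof.
split.
- split=> [u v|a u]; (apply: x_ext; first by rewrite /=; ring).
    by rewrite xmxD !xmx_xpt xmxD /conj_gen mulmxDr mulmxDl opprD addrACA.
  by rewrite xmxZ !xmx_xpt xmxZ /conj_gen -scalemxAr -scalemxAl scalerBr.
- move=> t; split=> [u v|a u]; (apply: x_ext; first by []).
    by rewrite xmxD !xmx_xpt xmxD /conj_mx mulmxDr mulmxDl.
  by rewrite xmxZ !xmx_xpt xmxZ /conj_mx -scalemxAr -scalemxAl.
- by move=> u v; rewrite !xip !xmx_xpt conj_gen_skew /=; ring.
- by move=> t u v; rewrite !xip !xmx_xpt conj_mx_adj.
move=> u; have [Rem [bR HR]] := conj_expand (xmx u).
have [C [C0 HC]] := conj_mx_norm_bound bR.
exists C; split=> // t t1.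
set h := t / 2.
have -> : esub (flow t u)
    (eadd u (eadd (escal t (flow_gen u)) (escal (t * t / 2) (flow_gen (flow_gen u))))) =
    escal (h * h * h) (xpt 0 (Rem t)).
  apply: x_ext; first by rewrite /=; ring.
  rewrite /esub xmxD !xmxZ !xmxD !xmxZ !xmx_xpt (HR t h erefl).
  entrywise; rewrite -!(RplusE, RmultE) /h; field.
rewrite enorm_scal /h.
have -> : t / 2 * (t / 2) * (t / 2) = t * (t * t) / 8 by field.
rewrite /Rdiv Rabs_mult Rabs_mult (Rabs_pos_eq (t * t)); last exact: Rle_0_sqr.
rewrite (Rabs_pos_eq (/ 8)); last lra.
have T0 : 0 <= Rabs t * (t * t) by apply: Rmult_le_pos; [apply: Rabs_pos|apply: Rle_0_sqr].
move: (HC t t1) (enorm_ge0 (xpt 0 (Rem t))); move: (enorm _) => N NC N0.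
have := Rmult_le_compat_l _ _ _ T0 NC; have := Rmult_le_pos _ _ T0 N0; lra.
Qed.

Lemma conj_mx_critical (C X : 'M[R]_(m, n)) :
  (forall t, mip C (conj_mx t X) <= mip C X) -> mip C (conj_gen X) = 0.
Proof.
move=> H; have e Y : mip C Y = eip (xpt 0 C) (xpt 0 Y) by rewrite xip !xmx_xpt /=; ring.
rewrite e; have := @flow_critical _ _ _ (xpt 0 C) (xpt 0 X) flow_isometric.
rewrite /flow_gen /flow !xmx_xpt; apply=> t.
by rewrite -(e X) -(e (conj_mx t X)); apply: H.
Qed.

End Conjugation.

Lemma rsum_delta (I : finType) (i : I) (F : I -> R) :
  \big[Rplus/0]_l (if l == i then F l else 0) = F i.
Proof. by rewrite -big_mkcond big_pred1_eq. Qed.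

(** * Simultaneous singular value decomposition *)

Section MatrixLimits.
Implicit Types m n : nat.

Definition mcv m n (M : nat -> 'M[R]_(m, n)) (L : 'M[R]_(m, n)) : Prop :=
  forall i j, Un_cv (fun k => M k i j) (L i j).

Lemma mcv_const m n (L : 'M[R]_(m, n)) : mcv (fun _ => L) L.
Proof. by move=> i j; apply: cv_const. Qed.

Lemma mcv_tr m n (M : nat -> 'M[R]_(m, n)) L : mcv M L -> mcv (fun k => (M k)^T)%R (L^T)%R.
Proof. by move=> H i j; rewrite mxE; apply: cv_ext (H j i) => k; rewrite mxE. Qed.

Lemma mcv_mul m n q (M : nat -> 'M[R]_(m, q)) (N : nat -> 'M[R]_(q, n)) L L' :
  mcv M L -> mcv N L' -> mcv (fun k => M k *m N k)%R (L *m L')%R.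
Proof.
move=> H H' i j; rewrite mulmxEr.
by apply: cv_ext (cv_sum (fun l => cv_mul (H i l) (H' l j))) => k; rewrite mulmxEr.
Qed.

Lemma mcv_mip m n (C : 'M[R]_(m, n)) M L : mcv M L -> Un_cv (fun k => mip C (M k)) (mip C L).
Proof.
by move=> H; apply: cv_sum => i; apply: cv_sum => j; apply: cv_mul (cv_const _) (H i j).
Qed.

Lemma mcv_unique m n (M : nat -> 'M[R]_(m, n)) L L' : mcv M L -> mcv M L' -> L = L'.
Proof. by move=> H H'; apply/matrixP => i j; apply: cv_unique (H i j) (H' i j). Qed.

Lemma orth_closed q (U : nat -> 'M[R]_q) L : (forall k, orth (U k)) -> mcv U L -> orth L.
Proof.
move=> HU H; apply: mcv_unique (mcv_mul (mcv_tr H) H) _.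
by move=> i j; apply: cv_ext (cv_const _) => k /=; rewrite (HU k).
Qed.

(** Entries of orthogonal matrices are at most 1 in absolute value, so [max_attained] applies to
    closed sets of orthogonal pairs. *)
Lemma orth_max m n (S : 'M[R]_m -> 'M[R]_n -> Prop) (g : 'M[R]_m -> 'M[R]_n -> R) :
  (exists U V, S U V) -> (forall U V, S U V -> orth U /\ orth V) ->
  (forall U V LU LV, (forall k, S (U k) (V k)) -> mcv U LU -> mcv V LV ->
    S LU LV /\ Un_cv (fun k => g (U k) (V k)) (g LU LV)) ->
  exists U V, S U V /\ forall U' V', S U' V' -> g U' V' <= g U V.
Proof.
move=> [U0 [V0 S0]] So Scl.
pose E := coords_prod (coords_Mat m m) (coords_Mat n n).
have [|||[U V] [SU HU]] := @max_attained E (fun u => S (mx_of u.1) (mx_of u.2))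
  (fun u => g (mx_of u.1) (mx_of u.2)) (\big[Rplus/0]_(i : idx E) 1).
- by exists (of_mx U0, of_mx V0); rewrite /= !of_mxK.
- move=> u /So[o1 o2]; apply: Rle_trans (norm_le_co _) _; apply: rsum_le => -[[i j]|[i j]] _ /=.
    by have := orth_entry i j o1; rewrite mxE.
  by have := orth_entry i j o2; rewrite mxE.
- move=> u l Su cu; have := Scl (fun k => mx_of (u k).1) (fun k => mx_of (u k).2)
    (mx_of l.1) (mx_of l.2) Su; apply.
    by move=> i j; rewrite mxE; apply: cv_ext (cu (inl (i, j))) => k; rewrite mxE.
  by move=> i j; rewrite mxE; apply: cv_ext (cu (inr (i, j))) => k; rewrite mxE.
exists (mx_of U), (mx_of V); split=> // U' V' S'.
by have := HU (of_mx U', of_mx V'); rewrite /= !of_mxK; apply.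
Qed.

End MatrixLimits.

(** * Plane rotation generators and signed permutations *)

Section ElementaryOrthogonal.
Context (q : nat).

Definition elem_skew (a b : 'I_q) : 'M[R]_q := (delta_mx a b - delta_mx b a)%R.

Lemma elem_skew_skew (a b : 'I_q) : skew_sym (elem_skew a b).
Proof. by rewrite /skew_sym /elem_skew linearB /= !trmx_delta opprB. Qed.

Lemma delta_mxEr m n (a i : 'I_m) (b j : 'I_n) :
  (delta_mx a b : 'M[R]_(m, n))%R i j = if (i == a) && (j == b) then 1 else 0.
Proof. by rewrite mxE; case: andb. Qed.

Lemma delta_mull n (N : 'M[R]_(q, n)) (a b l : 'I_q) (k : 'I_n) :
  (delta_mx a b *m N)%R l k = if l == a then N b k else 0.
Proof.
rewrite mulmxEr -(rsum_delta b (fun x => if l == a then N x k else 0)).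
by apply: eq_bigr => x _; rewrite delta_mxEr; case: (l == a); case: (x == b) => /=; lra.
Qed.

Lemma delta_mulr n (N : 'M[R]_(n, q)) (a b k : 'I_q) (l : 'I_n) :
  (N *m delta_mx a b)%R l k = if k == b then N l a else 0.
Proof.
rewrite mulmxEr -(rsum_delta a (fun x => if k == b then N l x else 0)).
by apply: eq_bigr => x _; rewrite delta_mxEr; case: (k == b); case: (x == a) => /=; lra.
Qed.

Lemma elem_skew_mull n (N : 'M[R]_(q, n)) (a b l : 'I_q) (k : 'I_n) :
  (elem_skew a b *m N)%R l k = (if l == a then N b k else 0) - (if l == b then N a k else 0).
Proof. by rewrite /elem_skew mulmxBl !mxEr !delta_mull. Qed.

Lemma elem_skew_mulr n (N : 'M[R]_(n, q)) (a b k : 'I_q) (l : 'I_n) :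
  (N *m elem_skew a b)%R l k = (if k == b then N l a else 0) - (if k == a then N l b else 0).
Proof. by rewrite /elem_skew mulmxBr !mxEr !delta_mulr. Qed.

(** Finite competitors for the maximization: transpositions decide the order of diagonal entries and
    sign changes their sign, which first-order conditions cannot see. *)
Definition signed_perm (e : 'I_q -> R) (sigma : 'I_q -> 'I_q) : 'M[R]_q :=
  (\matrix_(l, l') (if l' == sigma l then e l else 0))%R.

Lemma signed_perm_mull n (N : 'M[R]_(q, n)) e sigma (l : 'I_q) (k : 'I_n) :
  (signed_perm e sigma *m N)%R l k = e l * N (sigma l) k.
Proof.
rewrite mulmxEr -(rsum_delta (sigma l) (fun x => e l * N x k)).
by apply: eq_bigr => x _; rewrite mxE; case: eqP => _ //; apply: Rmult_0_l.
Qed.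

Lemma signed_perm_mulr n (N : 'M[R]_(n, q)) e sigma (l : 'I_n) (k : 'I_q) :
  (N *m (signed_perm e sigma)^T)%R l k = N l (sigma k) * e k.
Proof.
rewrite mulmxEr -(rsum_delta (sigma k) (fun x => N l x * e k)).
by apply: eq_bigr => x _; rewrite !mxE; case: eqP => _ //; apply: Rmult_0_r.
Qed.

Lemma signed_perm_orth e sigma : (forall l, e l * e l = 1) -> injective sigma ->
  orth ((signed_perm e sigma)^T)%R.
Proof.
move=> He Hs; rewrite /orth trmxK; apply/matrixP => l l'.
rewrite signed_perm_mull idmxEr !mxE (inj_eq Hs).
by case: eqP => [->|_]; [apply: He|apply: Rmult_0_r].
Qed.

End ElementaryOrthogonal.

(** * Diagonal forms, maximizers of Brockett functions, and decompositions *)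

Section Diagonal.
Context (m n : nat) (Hmn : (m <= n)%N).

Let w : 'I_m -> 'I_n := widen_ord Hmn.

Definition diag (s : 'I_m -> R) : 'M[R]_(m, n) :=
  (\matrix_(i, j) (if nat_of_ord i == nat_of_ord j then s i else 0))%R.

Lemma diagE s (i : 'I_m) (k : 'I_n) :
  diag s i k = if nat_of_ord i == nat_of_ord k then s i else 0.
Proof. by rewrite mxE. Qed.

Lemma widen_inj : injective w.
Proof. by move=> i j /(congr1 val) /= e; apply: val_inj. Qed.

Lemma widenP (k : 'I_n) : (exists i, k = w i) \/ (m <= k)%N.
Proof.
case: (ltnP k m) => h; last by right.
by left; exists (Ordinal h); apply: val_inj.
Qed.

Lemma widen_neq i (k : 'I_n) : (m <= k)%N -> (k == w i) = false.
Proof.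
by move=> h; apply/eqP => e; move: h; rewrite e /= leqNgt ltn_ord.
Qed.

Lemma diag_widen s i j : diag s i (w j) = if i == j then s i else 0.
Proof. by rewrite mxE. Qed.

Lemma diag_out s i (k : 'I_n) : (m <= k)%N -> diag s i k = 0.
Proof.
by move=> h; rewrite mxE; case: eqP => // e; move: h; rewrite -e leqNgt ltn_ord.
Qed.

Lemma mip_diag s (M : 'M[R]_(m, n)) : mip (diag s) M = \big[Rplus/0]_i (s i * M i (w i)).
Proof.
apply: eq_bigr => i _; rewrite -(rsum_delta (w i) (fun k => s i * M i k)).
apply: eq_bigr => k _; case: (widenP k) => [[j ->]|h].
  rewrite diag_widen (inj_eq widen_inj) eq_sym; case: eqP => _; ring.
rewrite diag_out // widen_neq //; ring.
Qed.

Lemma diag_ext (M : 'M[R]_(m, n)) s : (forall i, M i (w i) = s i) ->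
  (forall i j, i != j -> M i (w j) = 0) -> (forall i (k : 'I_n), (m <= k)%N -> M i k = 0) ->
  M = diag s.
Proof.
move=> H1 H2 H3; apply/matrixP => i k; case: (widenP k) => [[j ->]|h].
  by rewrite diag_widen; case: eqP => [<-//|/eqP]; apply: H2.
by rewrite diag_out // H3.
Qed.

(** Strict decrease separates the indices and sorts the diagonal of a maximizer; positivity fixes
    its signs. *)
Definition weight (i : 'I_m) : R := INR (m - i).

Lemma weight_pos i : 0 < weight i.
Proof. by apply: (lt_INR 0); apply/ltP; rewrite subn_gt0. Qed.

Lemma weight_decr (i j : 'I_m) : (i < j)%N -> weight j < weight i.
Proof. by move=> ij; apply: lt_INR; apply/ltP; apply: ltn_sub2l => //; apply: ltn_trans ij _. Qed.

Definition brockett (N : 'M[R]_(m, n)) := mip (diag weight) N.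

(* The constraint on P, Q in [Nmax] is the stabilizer of [diag s] in O(m) x O(n); for s = 0 it is
   the whole group, which is how [svd_mx] uses this section. *)
Section Position.
Context (s : 'I_m -> R) (N : 'M[R]_(m, n)).
Context (Nmax : forall P Q, orth P -> orth Q -> (P^T *m diag s *m Q = diag s)%R ->
  brockett (P^T *m N *m Q)%R <= brockett N).

(** By [cayley_comm] the rotations generated by (A, B) stay in the stabilizer of diag s, so
    maximality of [N] gives the first-order condition along them. *)
Lemma position_critical A B : skew_sym A -> skew_sym B -> (A *m diag s = diag s *m B)%R ->
  mip (diag weight) (A *m N)%R = mip (diag weight) (N *m B)%R.
Proof.
move=> sA sB e.
have := conj_mx_critical sA sB (C := diag weight) (X := N).
rewrite /conj_gen mipDr mipNr => H.
suff : mip (diag weight) (A *m N)%R + - mip (diag weight) (N *m B)%R = 0 by lra.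
apply: H => t.
have oA := rotation_orth sA t; have oB := rotation_orth sB t.
have := Nmax (orth_tr oA) (orth_tr oB); rewrite !trmxK /brockett /conj_mx; apply.
have -> : (rotation A t *m diag s = diag s *m rotation B t)%R.
  by apply: cayley_comm; [exact: skewZ|exact: skewZ|rewrite -scalemxAl -scalemxAr e].
by rewrite -mulmxA orthV // mulmx1.
Qed.

(** For equal s_i and s_j, rotating the planes (i, j) on both sides at once is admissible;
    criticality reads (weight i - weight j)(N_ij + N_ji) = 0. *)
Lemma position_anti i j : i != j -> s i = s j -> N i (w j) = - N j (w i).
Proof.
move=> ij eij.
have comm : (elem_skew i j *m diag s = diag s *m elem_skew (w i) (w j))%R.
  apply/matrixP => l k; rewrite elem_skew_mull elem_skew_mulr !diag_widen.
  case: (widenP k) => [[k' ->]|h]; last by rewrite !diag_out // !widen_neq //; case: ifP; case: ifP.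
  rewrite !diag_widen !(inj_eq widen_inj) (eq_sym k' j) (eq_sym k' i).
  case: (j =P k') => _; case: (i =P k') => _; case: (l =P i) => [->|_];
    case: (_ =P j) => [e|_]; rewrite ?e ?eij; lra.
have := position_critical (elem_skew_skew i j) (elem_skew_skew (w i) (w j)) comm.
rewrite !mip_diag.
have -> : \big[Rplus/0]_l (weight l * (elem_skew i j *m N)%R l (w l)) =
    weight i * N j (w i) - weight j * N i (w j).
  rewrite -(rsum_delta i (fun l => weight l * N j (w l))).
  rewrite -(rsum_delta j (fun l => weight l * N i (w l))) /Rminus.
  rewrite (_ : forall x, - x = (-1) * x); last by move=> ?; ring.
  rewrite -rsum_scal -rsum_add; apply: eq_bigr => l _; rewrite elem_skew_mull.
  by case: ifP; case: ifP; lra.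
have -> : \big[Rplus/0]_l (weight l * (N *m elem_skew (w i) (w j))%R l (w l)) =
    weight j * N j (w i) - weight i * N i (w j).
  rewrite -(rsum_delta i (fun l => weight l * N l (w j))).
  rewrite -(rsum_delta j (fun l => weight l * N l (w i))) /Rminus.
  rewrite (_ : forall x, - x = (-1) * x); last by move=> ?; ring.
  rewrite -rsum_scal -rsum_add; apply: eq_bigr => l _.
  by rewrite elem_skew_mulr !(inj_eq widen_inj); case: ifP; case: ifP; lra.
have : weight i <> weight j.
  by case: (ltngtP i j) ij => [/weight_decr|/weight_decr|/val_inj ->]; rewrite ?eqxx //; lra.
move=> ne e; have : (weight i - weight j) * (N i (w j) + N j (w i)) = 0 by lra.
by case/Rmult_integral; lra.
Qed.

(** When both singular values vanish, the left rotation alone is admissible; with antisymmetry it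
    gives (weight i + weight j) N_ij = 0. *)
Lemma position_null i j : i != j -> s i = 0 -> s j = 0 -> N i (w j) = 0.
Proof.
move=> ij si sj; have anti := position_anti ij (etrans si (esym sj)).
have comm : (elem_skew i j *m diag s = diag s *m (0 : 'M_n))%R.
  rewrite mulmx0; apply/matrixP => l k; rewrite elem_skew_mull zeromxEr !diagE.
  by rewrite si sj; do ?case: ifP => _; lra.
have s0 : skew_sym (0 : 'M[R]_n)%R by rewrite /skew_sym trmx0 oppr0.
have := position_critical (elem_skew_skew i j) s0 comm; rewrite mulmx0 !mip_diag.
rewrite [X in _ = X]big1; last by move=> l _; rewrite zeromxEr; ring.
have -> : \big[Rplus/0]_l (weight l * (elem_skew i j *m N)%R l (w l)) =
    weight i * N j (w i) - weight j * N i (w j).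
  rewrite -(rsum_delta i (fun l => weight l * N j (w l))).
  rewrite -(rsum_delta j (fun l => weight l * N i (w l))) /Rminus.
  rewrite (_ : forall x, - x = (-1) * x); last by move=> ?; ring.
  rewrite -rsum_scal -rsum_add; apply: eq_bigr => l _; rewrite elem_skew_mull.
  by case: ifP; case: ifP; lra.
have -> : N j (w i) = - N i (w j) by lra.
move=> e; have : (weight i + weight j) * N i (w j) = 0 by lra.
by have := weight_pos i; have := weight_pos j => ? ?; case/Rmult_integral => [h|//]; exfalso; lra.
Qed.

(** For s_i = 0 a right rotation may mix column i with a column k beyond the diagonal; criticality
    reads weight i * N_ik = 0. *)
Lemma position_out i (k : 'I_n) : s i = 0 -> (m <= k)%N -> N i k = 0.
Proof.
move=> si mk.
have comm : ((0 : 'M_m) *m diag s = diag s *m elem_skew (w i) k)%R.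
  rewrite mul0mx; apply/matrixP => l k'; rewrite elem_skew_mulr zeromxEr (diag_out s l mk).
  by rewrite diag_widen; case: (l =P i) => [->|_]; rewrite ?si; do ?case: ifP => _; lra.
have s0 : skew_sym (0 : 'M[R]_m)%R by rewrite /skew_sym trmx0 oppr0.
have := position_critical s0 (elem_skew_skew (w i) k) comm; rewrite mul0mx !mip_diag.
rewrite [X in X = _]big1; last by move=> l _; rewrite zeromxEr; ring.
have -> : \big[Rplus/0]_l (weight l * (N *m elem_skew (w i) k)%R l (w l)) =
    - (weight i * N i k).
  rewrite -(rsum_delta i (fun l => weight l * N l k)).
  rewrite (_ : forall x, - x = (-1) * x); last by move=> ?; ring.
  rewrite -rsum_scal; apply: eq_bigr => l _.
  by rewrite elem_skew_mulr eq_sym (widen_neq _ mk) (inj_eq widen_inj); case: ifP; lra.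
move=> e; have : weight i * N i k = 0 by lra.
by have := weight_pos i => ?; case/Rmult_integral => [h|//]; exfalso; lra.
Qed.

(** Transposing i and j on both sides is admissible and lowers the Brockett value by (weight i -
    weight j)(N_ii - N_jj). *)
Lemma position_swap (i j : 'I_m) : (i < j)%N -> s i = s j -> N j (w j) <= N i (w i).
Proof.
move=> ij eij.
pose P := ((signed_perm (fun _ => 1) (tperm i j))^T)%R.
pose Q := ((signed_perm (fun _ => 1) (tperm (w i) (w j)))^T)%R.
have oP : orth P by apply: signed_perm_orth => [l|]; [exact: Rmult_1_l|apply: perm_inj].
have oQ : orth Q by apply: signed_perm_orth => [l|]; [exact: Rmult_1_l|apply: perm_inj].
have tw l : tperm (w i) (w j) (w l) = w (tperm i j l).
  case: tpermP => [/widen_inj ->|/widen_inj ->|/eqP li /eqP lj].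
  - by rewrite tpermL.
  - by rewrite tpermR.
  by rewrite tpermD // eq_sym -(inj_eq widen_inj).
have tout (k : 'I_n) : (m <= k)%N -> tperm (w i) (w j) k = k.
  by move=> mk; rewrite tpermD // eq_sym widen_neq.
have ent (M : 'M[R]_(m, n)) l k :
    (P^T *m M *m Q)%R l k = M (tperm i j l) (tperm (w i) (w j) k).
  by rewrite signed_perm_mulr trmxK signed_perm_mull Rmult_1_r Rmult_1_l.
have stab : (P^T *m diag s *m Q = diag s)%R.
  apply/matrixP => l k; rewrite ent; case: (widenP k) => [[k' ->]|mk].
    rewrite tw !diag_widen (inj_eq perm_inj); case: eqP => // _.
    by case: tpermP => [->|->|].
  by rewrite tout // !diag_out.
have := Nmax oP oQ stab; rewrite /brockett !mip_diag.
rewrite (bigD1 i) // (bigD1 j) /=; last by rewrite neq_ltn ij orbT.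
rewrite [X in _ <= X](bigD1 i) // [X in _ <= _ + X](bigD1 j) /=; last by rewrite neq_ltn ij orbT.
rewrite !ent !tw tpermL tpermR.
set r1 := \big[_/_]_(_ | _) _; set r2 := \big[_/_]_(_ | _) _.
have -> : r1 = r2.
  apply: eq_bigr => l /andP[li lj]; rewrite ent tw tpermD 1?eq_sym //.
have := weight_decr ij => h1 h2.
have : 0 <= (weight i - weight j) * (N i (w i) - N j (w j)) by lra.
nra.
Qed.

(** Changing the sign of row i is admissible and lowers the Brockett value by 2 weight i * N_ii. *)
Lemma position_flip i : s i = 0 -> 0 <= N i (w i).
Proof.
move=> si.
pose e (l : 'I_m) := if l == i then -1 else 1.
pose P := ((signed_perm e id)^T)%R.
have oP : orth P.
  by apply: signed_perm_orth => [l|]; [rewrite /e; case: ifP; lra|exact: inj_id].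
have stab : (P^T *m diag s *m 1%:M = diag s)%R.
  apply/matrixP => l k; rewrite mulmx1 trmxK signed_perm_mull /e !diagE.
  by case: (l =P i) => [->|_]; rewrite ?si; case: ifP; lra.
have := Nmax oP (@orth1 _) stab; rewrite mulmx1 /brockett !mip_diag.
rewrite (bigD1 i) // [X in _ <= X](bigD1 i) //= trmxK signed_perm_mull /e eqxx.
set r1 := \big[_/_]_(_ | _) _; set r2 := \big[_/_]_(_ | _) _.
have -> : r1 = r2.
  by apply: eq_bigr => l li; rewrite signed_perm_mull (negbTE li); ring.
have := weight_pos i; nra.
Qed.

End Position.

(** At a maximizer over the whole group, [position_null] and [position_out] with s = 0 clear the
    off-diagonal entries; sign changes and transpositions make the diagonal nonnegative and
    decreasing. *)
Lemma svd_mx (X : 'M[R]_(m, n)) : exists U V s, [/\ orth U, orth V,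
  X = (U *m diag s *m V^T)%R, forall i, 0 <= s i & forall i j : 'I_m, (i <= j)%N -> s j <= s i].
Proof.
have [||U V LU LV oUV cU cV|U [V [[oU oV] HUV]]] := @orth_max m n (fun U V => orth U /\ orth V)
  (fun U V => brockett (U^T *m X *m V)%R).
- by exists 1%:M%R, 1%:M%R; split; apply: orth1.
- by [].
- split; first by split; [apply: orth_closed cU|apply: orth_closed cV] => k; case: (oUV k).
  by apply: mcv_mip; apply: mcv_mul cV; apply: mcv_mul (mcv_const X); apply: mcv_tr.
pose N := (U^T *m X *m V)%R.
have Nmax P Q : orth P -> orth Q -> (P^T *m diag (fun _ => 0) *m Q = diag (fun _ => 0))%R ->
    brockett (P^T *m N *m Q)%R <= brockett N.
  move=> oP oQ _; have := HUV (U *m P)%R (V *m Q)%R (conj (orthM oU oP) (orthM oV oQ)).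
  by rewrite trmx_mul /N !mulmxA.
exists U, V, (fun i => N i (w i)); split=> //.
- rewrite -(@diag_ext N _ (fun _ => erefl)).
  + by rewrite /N !mulmxA orthV // mul1mx -mulmxA orthV // mulmx1.
  + by move=> i j ij; apply: (position_null Nmax).
  + by move=> i k mk; apply: (position_out Nmax).
- by move=> i; apply: (position_flip Nmax).
move=> i j; rewrite leq_eqVlt => /orP[/eqP/val_inj ->|ij]; first by right.
exact: (position_swap Nmax ij).
Qed.

(** Zero padding: columns beyond the m-th count as having singular value 0, so one formula for B
    covers all column indices. *)
Definition extend (f : 'I_m -> R) (k : nat) : R := if insub k is Some i then f i else 0.

Lemma extend_ord f (i : 'I_m) : extend f i = f i.
Proof. by rewrite /extend valK. Qed.

Lemma extend_out f k : (m <= k)%N -> extend f k = 0.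
Proof. by move=> h; rewrite /extend insubF // ltnNge h. Qed.

(* Off-diagonal entries whose indices carry different singular values are removed by solving the
   2 x 2 systems  N_ij - A_ij s_j + s_i B_ij = 0,  N_ji + A_ij s_i - s_j B_ij = 0. *)
Lemma position_reduce s (N : 'M[R]_(m, n)) :
  (forall i, 0 <= s i) ->
  (forall i j, i != j -> s i = s j -> N i (w j) = - N j (w i)) ->
  (forall i j, i != j -> s i = 0 -> s j = 0 -> N i (w j) = 0) ->
  (forall i (k : 'I_n), s i = 0 -> (m <= k)%N -> N i k = 0) ->
  exists A B, [/\ skew_sym A, skew_sym B &
    (N - conj_gen A B (diag s))%R = diag (fun i => N i (w i))].
Proof.
move=> s0 Nanti Nnull Nout.
pose sx := extend s.
pose NN (a : nat) (l : 'I_n) := extend (fun i => N i l) a.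
(* For equal nonzero singular values B_ij = 0 and A_ij = N_ij / s_i solve the system, consistently
   by antisymmetry. If both are 0, then N_ij = 0 and the quotient is multiplied by 0. *)
pose aF i j := if i == j then 0 else if Req_dec_T (s i) (s j) then N i (w j) / s i
  else (s j * N i (w j) + s i * N j (w i)) / (s j * s j - s i * s i).
pose bF (k l : 'I_n) := if Req_dec_T (sx k) (sx l) then 0
  else (sx k * NN k l + sx l * NN l k) / (sx l * sx l - sx k * sx k).
pose A := (\matrix_(i, j) aF i j : 'M[R]_m)%R.
pose B := (\matrix_(k, l) bF k l : 'M[R]_n)%R.
have sq a b : 0 <= a -> 0 <= b -> a <> b -> a * a - b * b <> 0.
  move=> a0 b0 ab h; apply: ab; have : (a - b) * (a + b) = 0 by lra.
  by case/Rmult_integral; lra.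
have sx0 k : 0 <= sx k by rewrite /sx /extend; case: insub => [i|]; [apply: s0|lra].
exists A, B; split.
- apply/matrixP => i j; rewrite oppmxEr !mxE /aF eq_sym.
  case: (i =P j) => [_|/eqP ij]; first by rewrite Ropp_0.
  case: Req_dec_T => e1; case: Req_dec_T => e2 /=; try by [case: e1|case: e2].
    by rewrite (Nanti i j) // e2 /Rdiv; lra.
  by rewrite /=; field; split; apply: sq => //; apply: nesym.
- apply/matrixP => k l; rewrite oppmxEr !mxE /bF.
  case: Req_dec_T => e1; case: Req_dec_T => e2 /=; try by [case: e1|case: e2].
    by rewrite Ropp_0.
  by field; split; apply: sq => //; apply: nesym.
have eA i j : (A *m diag s)%R i (w j) = A i j * s j.
  rewrite mulmxEr -(rsum_delta j (fun x => A i x * s x)); apply: eq_bigr => x _.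
  by rewrite diag_widen; case: ifP => _; lra.
have eAo i (k : 'I_n) : (m <= k)%N -> (A *m diag s)%R i k = 0.
  by move=> mk; rewrite mulmxEr big1 // => x _; rewrite diag_out //; lra.
have eB i k : (diag s *m B)%R i k = s i * B (w i) k.
  rewrite mulmxEr -(rsum_delta (w i) (fun x => s i * B x k)); apply: eq_bigr => x _.
  case: (widenP x) => [[x' ->]|mx].
    by rewrite diag_widen (inj_eq widen_inj) eq_sym; case: eqP => [->|_]; lra.
  by rewrite diag_out // widen_neq //; lra.
have NNw i k : NN (w i) k = N i k by rewrite /NN extend_ord.
have sxw i : sx (w i) = s i by rewrite /sx extend_ord.
apply: diag_ext => [i|i j ij|i k mk]; rewrite /conj_gen !mxEr eB.
- rewrite eA [A i i]mxE [B _ _]mxE /aF /bF eqxx; case: Req_dec_T => [_|//] /=; lra.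
- rewrite eA [A i j]mxE [B _ _]mxE /aF /bF (negbTE ij) !sxw !NNw.
  case: Req_dec_T => e /=; last by field; apply: sq => //; apply: nesym.
  case: (Req_dec (s i) 0) => si; first by rewrite Nnull // -?e // si; lra.
  by move: (s i) (s j) e si => a b <- a0; field.
rewrite eAo // [B _ _]mxE /bF sxw NNw /sx /NN !(extend_out _ mk).
case: Req_dec_T => e /=; first by rewrite Nout // e; lra.
by field.
Qed.

(** X is diagonalized first; a Brockett maximization over the stabilizer of its diagonal form then
    normalizes H inside the blocks of equal singular values, and [position_reduce] removes the rest
    by a generator. The sign and order conditions on mu are those that make s + t mu a nonnegative
    decreasing vector for small t >= 0. *)
Lemma simultaneous_svd (X H : 'M[R]_(m, n)) : exists A B U V s mu,
  [/\ skew_sym A, skew_sym B, orth U /\ orth V,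
    X = (U *m diag s *m V^T)%R /\ (H - conj_gen A B X = U *m diag mu *m V^T)%R &
    (forall i, 0 <= s i) /\ (forall i, s i = 0 -> 0 <= mu i) /\
    (forall i j : 'I_m, (i <= j)%N -> s j <= s i /\ (s i = s j -> mu j <= mu i))].
Proof.
have [U0 [V0 [s [oU0 oV0 eX s0 sord]]]] := svd_mx X.
pose N0 := (U0^T *m H *m V0)%R.
pose S P Q := [/\ orth P, orth Q & (P^T *m diag s *m Q = diag s)%R].
have [||P Q LP LQ SPQ cP cQ|P [Q [[oP oQ ePQ] HPQ]]] := @orth_max m n S
  (fun P Q => brockett (P^T *m N0 *m Q)%R).
- by exists 1%:M%R, 1%:M%R; split; [apply: orth1|apply: orth1|rewrite trmx1 mul1mx mulmx1].
- by move=> P Q [].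
- have cv (M : 'M[R]_(m, n)) : mcv (fun k => (P k)^T *m M *m Q k)%R (LP^T *m M *m LQ)%R.
    by apply: mcv_mul cQ; apply: mcv_mul (mcv_const M); apply: mcv_tr.
  split; last exact: mcv_mip.
  split; [by apply: orth_closed cP => k; case: (SPQ k)|by apply: orth_closed cQ => k; case: (SPQ k)|].
  apply: mcv_unique (cv (diag s)) _ => i j; apply: cv_ext (cv_const _) => k.
  by case: (SPQ k) => _ _ ->.
pose N := (P^T *m N0 *m Q)%R.
have Nmax P' Q' : orth P' -> orth Q' -> (P'^T *m diag s *m Q' = diag s)%R ->
    brockett (P'^T *m N *m Q')%R <= brockett N.
  move=> oP' oQ' e; have := HPQ (P *m P')%R (Q *m Q')%R; rewrite trmx_mul /N !mulmxA; apply.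
  by split; [apply: orthM|apply: orthM|rewrite trmx_mul !mulmxA -(mulmxA P'^T)%R -mulmxA ?mulmxA -(mulmxA _ (P^T)%R) -(mulmxA _ _ Q) ePQ].
have [A' [B' [sA' sB' red]]] := @position_reduce s N s0 (position_anti Nmax)
  (position_null Nmax) (position_out Nmax).
pose U := (U0 *m P)%R; pose V := (V0 *m Q)%R.
have oU : orth U by apply: orthM.
have oV : orth V by apply: orthM.
have eXU : X = (U *m diag s *m V^T)%R.
  rewrite /U /V trmx_mul eX -{1}ePQ.
  have -> : (U0 *m P *m diag s *m (Q^T *m V0^T) = U0 *m (P *m diag s *m Q^T) *m V0^T)%R.
    by rewrite !mulmxA.
  rewrite ePQ; congr (_ *m _ *m _)%R.
  by rewrite -{2}ePQ !mulmxA orthV // mul1mx -mulmxA orthV // mulmx1.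
have eH : H = (U *m N *m V^T)%R.
  rewrite /U /V /N /N0 trmx_mul !mulmxA -(mulmxA _ P) orthV // mulmx1 orthV // mul1mx.
  by rewrite -(mulmxA _ Q) orthV // mulmx1 -mulmxA orthV // mulmx1.
clearbody U V N.
(* The generators found in diagonal coordinates are carried back by U and V, which preserves
   skewness. *)
exists (U *m A' *m U^T)%R, (V *m B' *m V^T)%R, U, V, s, (fun i => N i (w i)); split=> //.
- by rewrite /skew_sym !trmx_mul trmxK sA' mulNmx mulmxN mulmxA.
- by rewrite /skew_sym !trmx_mul trmxK sB' mulNmx mulmxN mulmxA.
- split=> //; rewrite -red {1}eH {1}eXU /conj_gen mulmxBr mulmxBl; congr (_ - _)%R.
  rewrite mulmxBr mulmxBl !mulmxA -(mulmxA _ (U^T)%R U) oU mulmx1; congr (_ - _)%R.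
  by rewrite -(mulmxA _ (V^T)%R V) oV mulmx1.
split=> //; split; first by move=> i; apply: (position_flip Nmax).
move=> i j; rewrite leq_eqVlt => /orP[/eqP/val_inj ->|ij]; first by split; lra.
split; first by apply: sord; apply: ltnW.
by move=> e; apply: (position_swap Nmax ij).
Qed.

End Diagonal.

(** * The Ky Fan cone *)

Lemma eventually_all (I : finType) (P : I -> R -> Prop) :
  (forall i, exists T, 0 < T /\ forall t, 0 < t < T -> P i t) ->
  exists T, 0 < T /\ forall t, 0 < t < T -> forall i, P i t.
Proof.
move=> H; suff [T [T0 HT]] : exists T, 0 < T /\
    forall t, 0 < t < T -> forall i, i \in index_enum I -> P i t.
  by exists T; split=> // t Ht i; apply: HT => //; rewrite mem_index_enum.
elim: (index_enum I) => [|j r [T [T0 HT]]]; first by exists 1; split=> //; lra.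
have [T' [T'0 HT']] := H j; exists (Rmin T T'); split; first exact: Rmin_pos.
move=> t [t0 /Rmin_Rgt_l[h h']] i; rewrite inE => /orP[/eqP ->|]; first exact: HT'.
exact: HT.
Qed.

Lemma affine_eventually_ge0 a b : 0 <= a -> (a = 0 -> 0 <= b) ->
  exists T, 0 < T /\ forall t, 0 < t < T -> 0 <= a + t * b.
Proof.
move=> a0 ab; case: (Req_dec a 0) => [e|ne].
  exists 1; split=> [|t Ht]; first lra.
  have := Rmult_le_pos t b; have := ab e; lra.
have b0 := Rabs_pos b; have bb : - Rabs b <= b by rewrite /Rabs; case: Rcase_abs; lra.
exists (a / (Rabs b + 1)); split; first by apply: Rdiv_lt_0_compat; lra.
move=> t [t0 tT].
have := Rmult_lt_compat_r (Rabs b + 1) _ _ ltac:(lra) tT.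
have -> : a / (Rabs b + 1) * (Rabs b + 1) = a by field; lra.
nra.
Qed.

Section KyFan.
Context (m n k : nat) (Hmn : (m <= n)%N) (Hk1 : (1 <= k)%N) (Hkm : (k <= m)%N).

Let w : 'I_m -> 'I_n := widen_ord Hmn.

Notation KF := (KyFanCone m n k).

Definition first_k (l : 'I_m) : R := if (l < k)%N then 1 else 0.

Lemma first_k_sum (s : 'I_m -> R) :
  \big[Rplus/0]_(l < m | (l < k)%N) s l = \big[Rplus/0]_l (s l * first_k l).
Proof. by rewrite big_mkcond; apply: eq_bigr => l _; rewrite /first_k; case: ifP => _; ring. Qed.

Lemma orthogonal_mxP q (U : Mat q q) : orthogonal_mx q U <-> orth (mx_of U).
Proof.
split=> H.
  apply/matrixP => i j; rewrite mulmxEr idmxEr -H.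
  by apply: eq_bigr => l _; rewrite !mxE.
move=> i j; have := congr1 (fun M : 'M_q => M i j) H; rewrite mulmxEr idmxEr => <-.
by apply: eq_bigr => l _; rewrite !mxE.
Qed.

Lemma svd_entry (U : Mat m m) (V : Mat n n) s i j :
  (mx_of U *m diag n s *m (mx_of V)^T)%R i j =
  \big[Rplus/0]_(l < m) \big[Rplus/0]_(c < n)
    (U i l * (if nat_of_ord l == nat_of_ord c then s l else 0) * V j c).
Proof.
rewrite mulmxEr exchange_big; apply: eq_bigr => c _; rewrite mulmxEr big_distrl.
by apply: eq_bigr => l _; rewrite diagE !mxE.
Qed.

Lemma KyFan_intro (U : 'M[R]_m) (V : 'M[R]_n) s (x : XSp m n) : orth U -> orth V ->
  (forall i, 0 <= s i) -> (forall i j : 'I_m, (i <= j)%N -> s j <= s i) ->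
  xmx x = (U *m diag n s *m V^T)%R -> \big[Rplus/0]_l (s l * first_k l) <= x.1 -> KF x.
Proof.
move=> oU oV s0 ss e Hs; exists (of_mx U), (of_mx V), s; split; last by rewrite first_k_sum.
split; first by apply/orthogonal_mxP; rewrite of_mxK.
split; first by apply/orthogonal_mxP; rewrite of_mxK.
do 2!(split=> //); move=> i j; rewrite -svd_entry !of_mxK -e.
by rewrite mxE.
Qed.

Lemma KyFan_elim (x : XSp m n) : KF x -> exists U V s, [/\ orth U, orth V,
  (forall i, 0 <= s i) /\ (forall i j : 'I_m, (i <= j)%N -> s j <= s i),
  xmx x = (U *m diag n s *m V^T)%R & \big[Rplus/0]_l (s l * first_k l) <= x.1].
Proof.
move=> [U [V [s [[oU [oV [s0 [ss e]]]] Hs]]]]; exists (mx_of U), (mx_of V), s; split.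
- exact/orthogonal_mxP.
- exact/orthogonal_mxP.
- by [].
- by apply/matrixP => i j; rewrite svd_entry -e mxE.
by rewrite -first_k_sum.
Qed.

Lemma rsum_widen_le (F : 'I_n -> R) : (forall c, 0 <= F c) ->
  \big[Rplus/0]_j F (w j) <= \big[Rplus/0]_c F c.
Proof.
move=> F0.
have -> : \big[Rplus/0]_j F (w j) =
    \big[Rplus/0]_c \big[Rplus/0]_(j < m) (if c == w j then F c else 0).
  by rewrite exchange_big; apply: eq_bigr => j _; rewrite rsum_delta.
apply: rsum_le => c _; case: (widenP Hmn c) => [[i ->]|mc].
  rewrite -{2}(rsum_delta i (fun _ => F (w i))); right; apply: eq_bigr => j _.
  by rewrite (inj_eq (@widen_inj _ _ Hmn)) eq_sym.
by rewrite big1 // => j _; rewrite widen_neq.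
Qed.

(* With d_l the diagonal of P I_k Q^T, d_l <= e_l where 0 <= e_l <= 1 and sum e_l <= k. *)
Lemma von_neumann_first_k (P : 'M[R]_m) (Q : 'M[R]_n) s : orth P -> orth Q ->
  (forall i, 0 <= s i) -> (forall i j : 'I_m, (i <= j)%N -> s j <= s i) ->
  mip (diag n s) (P *m diag n first_k *m Q^T)%R <= \big[Rplus/0]_l (s l * first_k l).
Proof.
move=> oP oQ s0 ss; rewrite (mip_diag Hmn).
have f0 l : 0 <= first_k l <= 1 by rewrite /first_k; case: ifP; lra.
pose e l := / 2 * (\big[Rplus/0]_j (first_k j * (P l j * P l j)) +
  \big[Rplus/0]_j (first_k j * (Q (w l) (w j) * Q (w l) (w j)))).
have d_le l : (P *m diag n first_k *m Q^T)%R l (w l) <= e l.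
  rewrite /e -rsum_add -rsum_scal.
  rewrite (_ : (P *m diag n first_k *m Q^T)%R l (w l) =
    \big[Rplus/0]_j (first_k j * (P l j * Q (w l) (w j)))).
    apply: rsum_le => j _; have := f0 j; have := Rle_0_sqr (P l j - Q (w l) (w j)).
    rewrite /Rsqr; nra.
  rewrite -mulmxA mulmxEr; apply: eq_bigr => j _.
  rewrite mulmxEr -[RHS](rsum_delta (w j) (fun c => first_k j * (P l j * Q (w l) c))).
  rewrite -rsum_scal; apply: eq_bigr => c _; rewrite [(Q^T)%R _ _]mxE.
  case: (widenP Hmn c) => [[i ->]|mc].
    by rewrite (diag_widen Hmn) (inj_eq (@widen_inj _ _ Hmn)) eq_sym; case: ifP => _; lra.
  by rewrite diag_out // widen_neq //; lra.
have e01 l : 0 <= e l <= 1.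
  have h1 : 0 <= \big[Rplus/0]_j (first_k j * (P l j * P l j)) <= 1.
    split; first by apply: rsum_ge0 => j _; have := f0 j; have := Rle_0_sqr (P l j); rewrite /Rsqr; nra.
    rewrite -(orth_row l oP); apply: rsum_le => j _.
    by have := f0 j; have := Rle_0_sqr (P l j); rewrite /Rsqr; nra.
  have h2 : 0 <= \big[Rplus/0]_j (first_k j * (Q (w l) (w j) * Q (w l) (w j))) <= 1.
    split.
      by apply: rsum_ge0 => j _; have := f0 j; have := Rle_0_sqr (Q (w l) (w j)); rewrite /Rsqr; nra.
    rewrite -(orth_row (w l) oQ).
    apply: Rle_trans (@rsum_widen_le (fun c => Q (w l) c * Q (w l) c) (fun c => Rle_0_sqr _)).
    by apply: rsum_le => j _; have := f0 j; have := Rle_0_sqr (Q (w l) (w j)); rewrite /Rsqr; nra.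
  by rewrite /e; lra.
have esum : \big[Rplus/0]_l e l <= \big[Rplus/0]_l first_k l.
  rewrite /e rsum_scal rsum_add [X in _ * (X + _)]exchange_big [X in _ * (_ + X)]exchange_big /=.
  rewrite -rsum_add -rsum_scal; apply: rsum_le => j _; rewrite !rsum_scal (orth_col j oP).
  have := @rsum_widen_le (fun c => Q c (w j) * Q c (w j)) (fun c => Rle_0_sqr _).
  by rewrite (orth_col (w j) oQ); have := f0 j; nra.
(* The threshold is the k-th singular value, at zero-based index k - 1. Then (s_l - kap)(first_k l -
   e_l) >= 0 for every l, since s_l >= kap exactly where e_l <= first_k l is needed. *)
have k1m : (k.-1 < m)%N by rewrite prednK.
pose kap := s (Ordinal k1m).
have kap0 : 0 <= kap by apply: s0.
apply: (@Rle_trans _ (\big[Rplus/0]_l (s l * e l))).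
  by apply: rsum_le => l _; apply: Rmult_le_compat_l.
have : \big[Rplus/0]_l (s l * e l + kap * first_k l) <=
       \big[Rplus/0]_l (s l * first_k l + kap * e l).
  apply: rsum_le => l _; have := e01 l; rewrite /first_k; case: ltnP => h el.
    have : kap <= s l by apply: ss; rewrite /= -ltnS prednK.
    nra.
  have : s l <= kap by apply: ss; rewrite /=; apply: leq_trans (leq_pred _) h.
  nra.
rewrite !rsum_add (rsum_scal kap first_k) (rsum_scal kap e).
have := Rmult_le_compat_l _ _ _ kap0 esum; lra.
Qed.

(** The normals (-1, U I_k V^T) of the half-spaces whose intersection is the Ky Fan cone. *)
Definition dual_pt (U : 'M[R]_m) (V : 'M[R]_n) : XSp m n :=
  xpt (-1) (U *m diag n first_k *m V^T)%R.

Lemma eip_dual U V x :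
  eip (dual_pt U V) x = mip (U *m diag n first_k *m V^T)%R (xmx x) - x.1.
Proof. by rewrite xip xmx_xpt /=; ring. Qed.

Lemma mip_orth_diag (U U' : 'M[R]_m) (V V' : 'M[R]_n) A (B : 'M[R]_(m, n)) :
  mip (U *m A *m V^T)%R (U' *m B *m V'^T)%R =
  mip B ((U'^T *m U) *m A *m (V'^T *m V)^T)%R.
Proof. by rewrite mipC mip_mulr mip_mull trmxK trmx_mul trmxK !mulmxA. Qed.

Lemma mip_svd_diag (U : 'M[R]_m) (V : 'M[R]_n) a : orth U -> orth V ->
  mip (U *m diag n first_k *m V^T)%R (U *m diag n a *m V^T)%R = \big[Rplus/0]_l (a l * first_k l).
Proof.
move=> oU oV; rewrite mip_orth_diag oU oV trmx1 mul1mx mulmx1 (mip_diag Hmn).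
by apply: eq_bigr => l _; rewrite diag_widen eqxx.
Qed.

(** One direction is the trace inequality [von_neumann_first_k]; the other takes the singular
    vectors of x itself, where that inequality is an equality. Convexity, closedness and invariance
    under the flow follow from this form. *)
Lemma KyFan_dual (x : XSp m n) :
  KF x <-> forall U V, orth U -> orth V -> eip (dual_pt U V) x <= 0.
Proof.
split.
  move=> /KyFan_elim[U' [V' [s [oU' oV' [s0 ss] e Hs]]]] U V oU oV.
  rewrite eip_dual e mip_orth_diag.
  have H := von_neumann_first_k (orthM (orth_tr oU') oU) (orthM (orth_tr oV') oV) s0 ss.
  by apply: Rle_minus; apply: Rle_trans H Hs.
move=> H; have [U [V [s [oU oV e s0 ss]]]] := svd_mx Hmn (xmx x).
apply: (KyFan_intro oU oV s0 ss e); have := H U V oU oV.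
by rewrite eip_dual e mip_svd_diag //; lra.
Qed.

Lemma KyFan_cone : is_cone KF.
Proof.
move=> z a /KyFan_dual Kz a0; apply/KyFan_dual => U V oU oV.
by rewrite eipZr; move: (Kz U V oU oV); move: (eip _ z) => e ?; nra.
Qed.

Lemma KyFan_add u v : KF u -> KF v -> KF (eadd u v).
Proof.
move=> /KyFan_dual Ku /KyFan_dual Kv; apply/KyFan_dual => U V oU oV.
rewrite eipDr; move: (Ku U V oU oV) (Kv U V oU oV).
by move: (eip _ u) (eip _ v) => ? ? ? ?; lra.
Qed.

Lemma KyFan_zero : KF ezero.
Proof. by apply/KyFan_dual => U V _ _; rewrite eip0r; lra. Qed.

Lemma KyFan_closed u l : (forall i, KF (u i)) -> ecv u l -> KF l.
Proof.
move=> Ku cu; apply/KyFan_dual => U V oU oV.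
apply: (@cv_le _ (fun _ => 0) _ _ 0 _ (ecv_ip (ecv_const (dual_pt U V)) cu) (cv_const 0)).
by move=> i _; move/KyFan_dual: (Ku i); apply.
Qed.

Lemma KyFan_flow A B t u : skew_sym A -> skew_sym B -> KF u -> KF (flow A B t u).
Proof.
move=> sA sB /KyFan_dual Ku; apply/KyFan_dual => U V oU oV.
have := Ku ((rotation A t)^T *m U)%R ((rotation B t)^T *m V)%R
  (orthM (orth_tr (rotation_orth sA t)) oU) (orthM (orth_tr (rotation_orth sB t)) oV).
rewrite !eip_dual xmx_xpt /= /conj_mx; set M := (U *m _ *m _)%R.
have -> : mip M (rotation A t *m xmx u *m (rotation B t)^T)%R =
    mip (((rotation A t)^T *m U) *m diag n first_k *m ((rotation B t)^T *m V)^T)%R (xmx u).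
  rewrite mipC (mip_mulr (rotation B t)^T%R) (mip_mull (rotation A t)) mipC trmxK.
  by rewrite (trmx_mul ((rotation B t)^T)%R V) trmxK /M !mulmxA.
by [].
Qed.

(** After subtracting the generator term, the segment from A in direction D keeps fixed singular
    vectors and has singular values s + t mu, so its Ky Fan norm is affine for small t. Membership
    in the cone becomes finitely many affine inequalities, each strict at t = 0 or with a favourable
    slope. *)
Lemma KyFan_regular A Y : KF A -> normal_cone KF A Y -> parabolically_regular KF A Y.
Proof.
move=> KA NY; apply: (flow_parabolically_regular KyFan_cone KA NY) => D TD.
have [A' [B' [U [V [s [mu [sA sB [oU oV] [eX eH] [s0 [mu0 ss]]]]]]]]] :=
  simultaneous_svd Hmn (xmx A) (xmx D).
have flowP := @flow_isometric m n A' B' sA sB.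
exists (flow A' B'), (flow_gen A' B'); split=> //.
split; first by move=> t u; apply: KyFan_flow.
pose c := dual_pt U V.
have cK z : KF z -> eip c z <= 0 by move/KyFan_dual; apply.
set kap := \big[Rplus/0]_l (s l * first_k l).
set kap' := \big[Rplus/0]_l (mu l * first_k l).
have kapA : kap <= A.1 by have := cK _ KA; rewrite eip_dual eX mip_svd_diag // -/kap; lra.
(* If the norm constraint is active at A, then [c] is normal there: it is nonpositive on the tangent
   direction D, and it annihilates the generator term by criticality along the flow. *)
have slope : A.1 - kap = 0 -> 0 <= D.1 - kap'.
  move=> e; have cA : eip c A = 0 by rewrite eip_dual eX mip_svd_diag // -/kap; lra.
  have cL : eip c (flow_gen A' B' A) = 0.
    by apply: (flow_critical flowP) => t; rewrite cA; apply: cK; apply: KyFan_flow.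
  have cN : normal_cone KF A c by move=> z Kz; rewrite eipBr cA; move: (cK _ Kz); move: (eip c z) => ? ?; lra.
  have := normal_tangent_le cN TD.
  move: cL; rewrite !eip_dual xmx_xpt /= => cL.
  have : mip (U *m diag n first_k *m V^T)%R (xmx D - conj_gen A' B' (xmx A))%R = kap'.
    by rewrite eH mip_svd_diag.
  by rewrite mipDr mipNr; lra.
have [T1 [T10 HT1]] : exists T, 0 < T /\ forall t, 0 < t < T -> forall i, 0 <= s i + t * mu i.
  apply: (@eventually_all _ (fun i t => 0 <= s i + t * mu i)) => i.
  exact: affine_eventually_ge0 (s0 i) (mu0 i).
have [|T2 [T20 HT2]] := @eventually_all ('I_m * 'I_m)%type (fun ij t =>
    (ij.1 <= ij.2)%N -> s ij.2 + t * mu ij.2 <= s ij.1 + t * mu ij.1).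
  move=> -[i j] /=; case: (leqP i j) => h; last by exists 1; split=> //; lra.
  have [h1 h2] := ss i j h.
  have [||T [T0 HT]] := @affine_eventually_ge0 (s i - s j) (mu i - mu j); first lra.
    by move=> e; have := h2 ltac:(lra); lra.
  by exists T; split=> // t Ht _; have := HT t Ht; lra.
have [||T3 [T30 HT3]] := @affine_eventually_ge0 (A.1 - kap) (D.1 - kap'); [lra|by []|].
exists (Rmin (Rmin T1 T2) T3); split; first by do 2!(apply: Rmin_pos => //).
move=> t [t0 /Rmin_Rgt_l[/Rmin_Rgt_l[t1 t2] t3]].
apply: (KyFan_intro (s := fun i => s i + t * mu i) oU oV).
- by apply: HT1.
- by move=> i j; apply: (HT2 t (conj t0 t2) (i, j)).
- have -> : xmx (eadd A (escal t (esub D (flow_gen A' B' A)))) =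
      (xmx A + t *: (xmx D - conj_gen A' B' (xmx A)))%R.
    by rewrite xmxD xmxZ /esub xmxD xmxZ xmx_xpt; entrywise; lra.
  rewrite eH {1}eX scalemxAl scalemxAr -mulmxDl -mulmxDr; congr (_ *m _ *m _)%R.
  by apply/matrixP => i j; rewrite !mxEr !diagE; case: ifP; lra.
have -> : \big[Rplus/0]_l ((s l + t * mu l) * first_k l) = kap + t * kap'.
  by rewrite -rsum_scal -rsum_add; apply: eq_bigr => l _; ring.
have := HT3 t (conj t0 t3); rewrite /=; lra.
Qed.

End KyFan.

(** * Both perturbed systems as instances of the error bound *)

Theorem mainTheorem1 (m n k p : nat)
  (Hmn : (m <= n)%N) (Hk1 : (1 <= k)%N) (Hkm : (k <= m)%N)
  (f : XSp m n -> RSp) (Df : XSp m n -> XSp m n -> RSp)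
  (D2f : XSp m n -> XSp m n -> XSp m n -> RSp)
  (h : XSp m n -> RvSp p) (Dh : XSp m n -> XSp m n -> RvSp p)
  (D2h : XSp m n -> XSp m n -> XSp m n -> RvSp p)
  (G : XSp m n -> XSp m n) (DG : XSp m n -> XSp m n -> XSp m n)
  (D2G : XSp m n -> XSp m n -> XSp m n -> XSp m n)
  (Hf : C2 f Df D2f) (Hh : C2 h Dh D2h) (HG : C2 G DG D2G)
  (Xb : XSp m n) (lb : RvSp p) (Yb : XSp m n)
  (Hstat : stationary m n k p Df h Dh G DG Xb)
  (HM : multipliers m n k p Df Dh G DG Xb lb Yb)
  (HSOSC : SOSC m n k p Df D2f Dh D2h G DG D2G Xb)
  (HSRCQ : SRCQ m n k p Dh G DG Xb Yb) :
  loc_upper_lipschitz (J m n k p Df h Dh G DG) ezero (Xb, (lb, Yb)) /\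
  loc_upper_lipschitz (Jt m n k p Df h Dh G DG) ezero (Xb, (lb, Yb)).
Proof.
have [[hb KG] _] := Hstat; rewrite /K in KG.
have coneK := KyFan_cone Hmn Hk1 Hkm.
pose KF := KyFanCone m n k.
have eLX x lam Y d : eip (LX m n p Df Dh DG x lam Y) d = lagr_grad Df Dh DG x lam Y d.
  rewrite /LX eip_riesz //; have [[Df1 Df2] _] := proj1 Hf x.
  have [[Dh1 Dh2] _] := proj1 Hh x; have [[DG1 DG2] _] := proj1 HG x.
  split=> [u v|a u]; rewrite ?Df1 ?Dh1 ?DG1 ?Df2 ?Dh2 ?DG2 ?eipDr ?eipZr /=; ring.
have multP lam Y : multiplier Df Dh G DG KF Xb lam Y <-> multipliers m n k p Df Dh G DG Xb lam Y.
  split=> -[L N]; split=> //; last by move=> d; rewrite -eLX L eip0l.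
  by apply: eip_eq0; rewrite eLX L; lra.
have projN := proj_normal coneK (KyFan_zero Hmn Hk1 Hkm) (KyFan_add Hmn Hk1 Hkm)
  (KyFan_closed Hmn Hk1 Hkm).
have projE A Y : KF A -> normal_cone KF A Y -> proj KF (eadd A Y) = A.
  exact: (proj_eq coneK (KyFan_zero Hmn Hk1 Hkm) (KyFan_add Hmn Hk1 Hkm) (KyFan_closed Hmn Hk1 Hkm)).
have S Z : Dh Xb Z = ezero -> tangent_cone KF (G Xb) (DG Xb Z) -> Df Xb Z = 0 -> Z <> ezero ->
    exists lam Y, multiplier Df Dh G DG KF Xb lam Y /\
    support_lt Y (tangent2 KF (G Xb) (DG Xb Z))
      (D2f Xb Z Z + eip lam (D2h Xb Z Z) + eip Y (D2G Xb Z Z)).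
  move=> hZ TZ fZ Z0; have [lam [Y [/multP M sup]]] := HSOSC Z (conj hZ (conj TZ fZ)) Z0.
  by exists lam, Y.
have [mu [r [mu0 [r0 bound]]]] := kkt_error_bound Hf Hh HG coneK hb KG
  (proj2 (multP _ _) HM) (KyFan_regular Hmn Hk1 Hkm KG (proj2 HM)) S HSRCQ.
have PG : proj KF (eadd (G Xb) Yb) = G Xb by apply: projE => //; exact: (proj2 HM).
split; apply: (@loc_upper_lipschitz_of_bound _ _ _ _ _ mu r) => //.
- rewrite /J /Psi -/KF PG esubxx hb; congr pair; exact: (proj1 HM).
- move=> delta [x [lam Y]] near <-; rewrite /Psi -/KF.
  (* For [J], A is the projection of G(x) + Y and Y' = G(x) + Y - A. Both G(x) - A and Y' - Y equal
     the third component of the perturbation. *)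
  have [KA NA] := projN (eadd (G x) Y); set A := proj _ _ in KA NA *.
  set d := esub _ ezero.
  have d1 : enorm (LX m n p Df Dh DG x lam Y) <= enorm d.
    have -> : LX m n p Df Dh DG x lam Y = d.1 by rewrite /d esub0.
    exact: enorm_fst.
  have d2 : enorm (h x) <= enorm d.
    have -> : h x = d.2.1 by rewrite /d esub0.
    by apply: Rle_trans (enorm_snd d); apply: enorm_fst.
  have d3 : enorm (esub (G x) A) <= enorm d.
    have -> : esub (G x) A = d.2.2 by rewrite /d esub0.
    by apply: Rle_trans (enorm_snd d); apply: enorm_snd.
  apply: (bound x lam Y A _ _ near (enorm_ge0 d) KA NA) => //.
  + by rewrite enorm_subC.
  + by have -> : esub (esub (eadd (G x) Y) A) Y = esub (G x) A by evec; ring.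
  move=> e; rewrite -eLX; apply: Rle_trans (cauchy_schwarz _ _) _.
  by apply: Rmult_le_compat_r => //; apply: enorm_ge0.
- suff : (esub (LX m n p Df Dh DG Xb lb Yb) ezero, (esub (h Xb) ezero,
      esub (esub (G Xb) ezero) (proj KF (eadd (esub (G Xb) ezero) Yb)))) = ezero :> TripleSp m n p.
    by [].
  rewrite !esub0 PG esubxx hb; congr pair; exact: (proj1 HM).
move=> [df [dh dG]] [x [lam Y]] near; rewrite /Jt /Psit -/KF.
(* For [Jt], the projection equation makes A = G(x) - dG, so the projection residual Y' is Y itself
   and only A carries an error. *)
have [KA NA] := projN (eadd (esub (G x) dG) Y); set A := proj _ _ in KA NA *.
move=> zero.
have eL : LX m n p Df Dh DG x lam Y = df := esub_eq0 (congr1 (fun z => z.1) zero).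
have eh : h x = dh := esub_eq0 (congr1 (fun z => z.2.1) zero).
have eG : esub (G x) dG = A := esub_eq0 (congr1 (fun z => z.2.2) zero).
clear zero.
set d := esub _ ezero.
have d1 : enorm df <= enorm d.
  have -> : df = d.1 by rewrite /d esub0.
  exact: enorm_fst.
have d2 : enorm dh <= enorm d.
  have -> : dh = d.2.1 by rewrite /d esub0.
  by apply: Rle_trans (enorm_snd d); apply: enorm_fst.
have d3 : enorm dG <= enorm d.
  have -> : dG = d.2.2 by rewrite /d esub0.
  by apply: Rle_trans (enorm_snd d); apply: enorm_snd.
apply: (bound x lam Y A _ _ near (enorm_ge0 d) KA NA) => //.
- rewrite enorm_subC -eG; have -> // : esub (G x) (esub (G x) dG) = dG by evec; ring.
- rewrite -eG; have -> : esub (esub (eadd (esub (G x) dG) Y) (esub (G x) dG)) Y = ezero.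
    by evec; ring.
  by rewrite enorm0; apply: enorm_ge0.
- by rewrite eh.
move=> e; rewrite -eLX eL; apply: Rle_trans (cauchy_schwarz _ _) _.
by apply: Rmult_le_compat_r => //; apply: enorm_ge0.
Qed.
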